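(* Let $T\ge 3$ be an integer, $\mu=(\mu_1,\mu_2)\in\mathbb{R}^2$ and $\Delta=|\mu_1-\mu_2|$. If $T\Delta^2 > 4e^2$, the regret of the BAI-ETC algorithm is upper bounded as $$R_\mu^{\mathrm{BAI\text{-}ETC}}(T) \leq \frac{4\log\left(\frac{T\Delta^2}{4}\right)}{\Delta} + \frac{334\sqrt{\log\left(\frac{T\Delta^2}{4}\right)}}{\Delta} + \frac{178}{\Delta} + 2\Delta .$$ It is upper bounded by $T\Delta$ otherwise, and by $32\sqrt{T} + 2\Delta$ in any case.
   Context: Two-armed Gaussian bandit with known integer horizon $T$: at each time $t\in\{1,\dots,T\}$ the agent chooses $A_t\in\{1,2\}$ based on past observations and receives a reward $Z_t\sim\mathcal N(\mu_{A_t},1)$, where successive rewards from each arm are i.i.d. and the two arms are independent. Expectation under $\mu$ is denoted $\mathbb{E}_\mu$. The regret of a strategy $\pi$ is $R^\pi_\mu(T) = T \max\{\mu_1, \mu_2\} - \mathbb{E}_\mu\left[\sum_{t=1}^T \mu_{A_t}\right]$. For $i\in\{1,2\}$, $\hat\mu_{i,n}$ is the empirical mean of the first $n$ rewards from arm $i$. BAI-ETC algorithm (input $T\ge3$; $\Delta$ is unknown to the algorithm): define the stopping time $$\tau = \inf \left\{t=2n,\ n\ge 1,\ 2n\le T : |\hat{\mu}_{1,n} - \hat{\mu}_{2,n}|> \sqrt{\frac{4 \log\big(T/(2n)\big)}{n}} \right\},$$ with $\tau=\infty$ if no such $t$ exists. For $t\le\min(\tau,T)$ the algorithm plays arm $1$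 if $t$ is odd and arm $2$ if $t$ is even; for $\tau<t\le T$ it plays $\hat a=\operatorname{argmax}_i\hat\mu_{i,\tau/2}$, the empirically best arm at time $\tau$. *)

(* Defs.v *)
From HB Require Import structures.
From mathcomp Require Import all_boot all_order all_algebra.
From mathcomp Require Import all_classical all_reals all_analysis.
Set Implicit Arguments.
Unset Strict Implicit.
Unset Printing Implicit Defensive.
Import Order.TTheory GRing.Theory Num.Theory.
Import numFieldNormedType.Exports.
Local Open Scope classical_set_scope.
Local Open Scope ring_scope.

(* Measurability of each [B i] is asked for all [i], not only those in [J];
   this is no restriction, since only the [B i] with [i] in [J] matter. *)
Definition mutually_independent (d : measure_display) (Omega : measurableType d)
    (R : realType) (P : probability Omega R) (I : choiceType)
    (X : I -> {RV P >-> R}) : Prop :=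
  forall (J : seq I) (B : I -> set R),
    uniq J -> (forall i, measurable (B i)) ->
    P (\bigcap_(i in [set` J]) (X i @^-1` B i)) =
    (\prod_(i <- J) P (X i @^-1` B i))%E.

Definition arm1 : 'I_2 := ord0.
Definition arm2 : 'I_2 := ord_max.

(* [Y (i, k)] is the reward of the [k.+1]-th pull of arm [i]: the reward
   received at time [t] is [Y (A_t, k)], with [k] the number of earlier pulls
   of arm [A_t]. *)
Definition gaussian_bandit (d : measure_display) (Omega : measurableType d)
    (R : realType) (P : probability Omega R) (mu : 'I_2 -> R)
    (Y : 'I_2 * nat -> {RV P >-> R}) : Prop :=
  mutually_independent Y /\
  forall (i : 'I_2) (k : nat) (B : set R), measurable B ->
    distribution P (Y (i, k)) B = normal_prob (mu i) 1 B.

(* [A t w] is the arm played at time [t], for [1 <= t <= T]. *)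
Definition regret (d : measure_display) (Omega : measurableType d)
    (R : realType) (P : probability Omega R) (mu : 'I_2 -> R) (T : nat)
    (A : nat -> Omega -> 'I_2) : \bar R :=
  ((T%:R * Num.max (mu arm1) (mu arm2))%:E
    - 'E_P[fun w => (\sum_(1 <= t < T.+1) mu (A t w))%R])%E.

Section bai_etc.
Context (R : realType) (T : nat).

(* In this section [y] is one realization of the rewards of both arms. *)
Implicit Type y : 'I_2 * nat -> R.

Definition empirical_mean y (i : 'I_2) (n : nat) : R :=
  (\sum_(k < n) y (i, val k)) / n%:R.

Definition threshold (n : nat) : R :=
  Num.sqrt (4 * ln (T%:R / (2 * n)%:R) / n%:R).

Definition stops_after y (n : nat) : bool :=
  threshold n < `|empirical_mean y arm1 n - empirical_mean y arm2 n|.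

(* [None] encodes [tau = +oo]. The list is increasing and ranges over the
   [t = 2 * n] with [1 <= n] and [2 * n <= T], so its head is the infimum. *)
Definition tau y : option nat :=
  ohead [seq (2 * n)%N | n <- iota 1 T./2 & stops_after y n].

(* No tie-breaking rule is needed: at time [tau] the empirical means differ. *)
Definition best_arm y (n : nat) : 'I_2 :=
  [arg max_(i > arm1) empirical_mean y i n]%O.

Definition bai_etc y (t : nat) : 'I_2 :=
  let explore := if odd t then arm1 else arm2 in
  if tau y is Some s then
    if (t <= s)%N then explore else best_arm y s./2
  else explore.

End bai_etc.

(* Main.v *)
Require Import Defs.
From HB Require Import structures.
From mathcomp Require Import all_boot all_order all_algebra.
From mathcomp Require Import all_classical all_reals all_analysis.
From mathcomp Require Import measurable_realfun.
From mathcomp Require Import ring lra.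
Set Implicit Arguments.
Unset Strict Implicit.
Unset Printing Implicit Defensive.
Import Order.TTheory GRing.Theory Num.Theory.
Import numFieldNormedType.Exports.
Local Open Scope classical_set_scope.
Local Open Scope ring_scope.

(** Let [a] be the worse arm, [b] the better one, [D] the difference of their
    means, and [G n] the sum over the first [n] pairs of pulls of the reward of
    [b] minus that of [a], a Gaussian random walk of drift [D] and variance [2]
    per step. Write [l n = ln (T / (2 n))] and [L = ln (T D^2 / 4)]. The
    algorithm stops at the first [n] with [|G n| > 2 sqrt (n * l n)].

    The regret is [D] times the expected number of pulls of [a]. Along every
    path, that number is at most the number of [m <= T/2] at which the stopping
    test fails, plus [T] if the algorithm stops at some [n] with [G n < 0]
    ([pulls_le], [regret_le]). So two probabilities are needed.

    Both come from one tool. For every real [lam], the process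
    [exp (lam (n D - G n) - lam^2 n)] is a product of independent factors of
    mean one, hence it ever exceeds [exp x] with probability at most
    [exp (- x)] ([gap_crossing_prob]). Independence being given as a product
    rule for events, the maximal inequality behind it
    ([product_maximal_inequality]) is obtained by freezing the process once it
    crosses the level: the frozen process is a recursion driven by the
    independent rewards, so its state is independent of the next reward, its
    mean stays one, and Markov's inequality concludes.

    Exploration. With [lam = 1 / sqrt m], the test fails at [m] with
    probability at most [exp (1 - (D sqrt m - 2 sqrt L))] once
    [m >= 4 L / D^2] ([not_stopped_prob]). Below [4 L / D^2] the failures are
    counted one by one, which gives the leading term [4 L / D]; beyond it, the
    bound telescopes and contributes a multiple of [(1 + sqrt L) / D^2]
    ([exploration_sum]).

    Wrong stop. If [G n < - 2 sqrt (n * l n)], the best tilt is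
    [sqrt (l n / n)], and it gives the level [l n], that is, a probability of
    order [n / T]. A union bound over all [n] would lose a factor [1 / D^2].
    Instead the [n] are grouped into blocks [4^j <= n < 4^(j+1)], and on each
    block the tilts range over a grid of mesh [2^-j]: the nearest point of the
    grid loses at most [1] in the exponent, and a block needs about [sqrt L]
    points ([wrong_stop_crossing]). The drift multiplies the [k]-th term of
    block [j] by [exp (- (k + 1/2) D 2^j)], so that the sum over all blocks is
    dominated by those with [4^j] of order [1 / D^2], and [T] times the
    probability is at most a multiple of [sqrt L / D^2] ([wrong_stop_sum],
    [wrong_stop_prob]).

    Together these give a bound [(4 L + 156 sqrt L + 294) / D + 2 D]
    ([regret_le_separated]), which is below the announced one because
    [L >= 2]. The bound in [sqrt T] follows from the trivial bound [T D] when
    [T D^2 <= 1024] and from the previous one otherwise. *)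

(** * Density integrals and Gaussian exponential moments *)

Section measurable_comparison.
Context d (T : measurableType d) (R : realType) (f g : T -> R).
Hypotheses (mf : measurable_fun setT f) (mg : measurable_fun setT g).

Lemma measurable_le_set : measurable [set x | f x <= g x].
Proof.
rewrite -[X in measurable X]setTI.
exact: (measurable_fun_ler mf mg measurableT (Y := [set true])).
Qed.

Lemma measurable_lt_set : measurable [set x | f x < g x].
Proof.
rewrite -[X in measurable X]setTI.
exact: (measurable_fun_ltr mf mg measurableT (Y := [set true])).
Qed.

End measurable_comparison.

Section density.
Local Open Scope ereal_scope.
Context d (T : measurableType d) (R : realType).
Variables (mu nu : {measure set T -> \bar R}) (p : T -> R).
Hypotheses (mp : measurable_fun setT p) (p0 : forall x, (0 <= p x)%R).
Hypothesis nuE : forall A, measurable A -> nu A = \int[mu]_(x in A) (p x)%:E.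

Let integral_density_indic E : measurable E ->
  \int[nu]_x (\1_E x)%:E = \int[mu]_x ((\1_E x)%:E * (p x)%:E).
Proof.
move=> mE; rewrite integral_indic// setIT nuE// [LHS]integral_mkcond.
apply: eq_integral => x _; rewrite patchE indicE.
by case: ifPn => xE; rewrite ?mul1e ?mul0e.
Qed.

Import HBNNSimple.

Let integral_density_nnsfun (f : {nnsfun T >-> R}) :
  \int[nu]_x (f x)%:E = \int[mu]_x ((f x)%:E * (p x)%:E).
Proof.
under [LHS]eq_integral do rewrite fimfunE -fsumEFin//.
rewrite [LHS]ge0_integral_fsum//; last 2 first.
  - by move=> r; exact/measurable_EFinP/measurableT_comp.
  - by move=> n x _; rewrite EFinM nnfun_muleindic_ge0.
under [RHS]eq_integral.
  move=> x xD; rewrite fimfunE -fsumEFin// muleC ge0_mule_fsumr; last first.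
    by move=> r; rewrite EFinM nnfun_muleindic_ge0.
  over.
rewrite [RHS]ge0_integral_fsum//; last 2 first.
  - move=> r; apply: emeasurable_funM; first exact/measurable_EFinP.
    by apply/measurable_EFinP; do 2 apply/measurableT_comp => //.
  - move=> n x _; apply: mule_ge0; first by rewrite lee_fin.
    by rewrite EFinM nnfun_muleindic_ge0.
apply: eq_fsbigr => r; rewrite inE => -[x _ <-].
have f0 : (0 <= f x)%R by [].
rewrite [LHS]integralZl_indic_nnsfun//= integral_density_indic//.
rewrite -ge0_integralZl//=.
- by apply: eq_integral => y _; rewrite EFinM muleA muleC.
- apply: emeasurable_funM; last exact/measurable_EFinP.
  exact/measurable_EFinP/measurable_indic.
- by move=> y _; rewrite mule_ge0// lee_fin.
Qed.

(** Both sides agree on indicators, hence on nonnegative simple functions; the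
    general case is a monotone limit of those. *)
Lemma integral_density (f : T -> \bar R) :
  measurable_fun setT f -> (forall x, 0 <= f x) ->
  \int[nu]_x f x = \int[mu]_x (f x * (p x)%:E).
Proof.
move=> mf f0.
pose f_ := nnsfun_approx measurableT mf.
transitivity (lim (\int[nu]_x (f_ n x)%:E @[n --> \oo])).
  rewrite -monotone_convergence//=.
  - apply: eq_integral => ? /[!inE] xD; apply/esym/cvg_lim => //=.
    exact: cvg_nnsfun_approx.
  - by move=> n; exact/measurable_EFinP/measurable_funTS.
  - by move=> n ? _; rewrite lee_fin.
  - by move=> ? _ ? ? mn; rewrite lee_fin; exact/lefP/nd_nnsfun_approx.
under [in LHS]eq_fun do rewrite integral_density_nnsfun.
rewrite -monotone_convergence//=.
- apply: eq_integral => x _; apply/cvg_lim => //.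
  rewrite muleC; under eq_fun do rewrite muleC.
  by apply: cvgeZl => //; exact: cvg_nnsfun_approx.
- by move=> n; apply: emeasurable_funM; apply/measurable_EFinP.
- by move=> n x _; rewrite mule_ge0// lee_fin.
- move=> x _ m n mn; rewrite lee_pmul ?lee_fin//.
  exact/lefP/nd_nnsfun_approx.
Qed.

End density.

(** Multiplying the density of the normal law of mean [m] by this exponential
    gives the density of the normal law of mean [m + a]. *)
Lemma normal_tilt (R : realType) (m a : R) :
  (\int[normal_prob m 1]_x (expR (a * (x - m) - a ^+ 2 / 2))%:E = 1)%E.
Proof.
rewrite (@integral_density _ _ _ lebesgue_measure _ (normal_pdf m 1)) => //.
- rewrite -(integral_normal_pdf (m + a) 1); apply: eq_integral => x _.
  rewrite -EFinM !normal_pdfE ?oner_eq0// /normal_fun mulrCA -expRD.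
  by congr (_ * expR _)%:E; field.
- exact: measurable_normal_pdf.
- by move=> x; exact: normal_pdf_ge0.
- apply/measurable_EFinP; apply: measurableT_comp => //.
  apply: measurable_funB => //; apply: measurable_funM => //.
  exact: measurable_funB.
Qed.

(** The normal law lives on the real line with the sigma-algebra generated by
    half-open intervals, the law of [X] on the one with its default structure:
    the same measurable sets, but two distinct structures. The identity map
    transports one measure to the other. *)
Lemma normal_law_tilt (R : realType) d (Omega : measurableType d)
    (P : probability Omega R) (X : {RV P >-> R}) (m a : R) :
  (forall B : set R, measurable B -> distribution P X B = normal_prob m 1 B) ->
  (\int[distribution P X]_x (expR (a * (x - m) - a ^+ 2 / 2))%:E = 1)%E.
Proof.
move=> lawX; pose id' : measurableTypeR R -> R := idfun.
have mid : measurable_fun setT id' by exact: measurable_id.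
pose nu0 : {measure set R -> \bar R} := pushforward (normal_prob m 1) id'.
pose nu := nu0 mid.
rewrite (@eq_measure_integral _ _ _ _ nu); last by move=> B mB _; exact: lawX.
rewrite ge0_integral_pushforward//.
- by rewrite preimage_setT; exact: normal_tilt.
- apply/measurable_EFinP; apply: measurableT_comp => //.
  apply: measurable_funB => //; apply: measurable_funM => //.
  exact: measurable_funB.
Qed.

Section independent_pair.
Local Open Scope ereal_scope.
Context d (Omega : measurableType d) (R : realType) (P : probability Omega R).

(** The map sending [D] to [P ((X, Y) \in D, C) / P C] is a measure that takes
    the product value on every rectangle, and only the product measure does.
    The event [C] serves to carry along the inputs that come later in time. *)
Lemma independent_pair_law (X Y : {RV P >-> R}) (C : set Omega) :
  measurable C ->
  (forall A B, measurable A -> measurable B ->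
     P (X @^-1` A `&` Y @^-1` B) = P (X @^-1` A) * P (Y @^-1` B)) ->
  (forall A B, measurable A -> measurable B ->
     P (X @^-1` A `&` Y @^-1` B `&` C)
     = P (X @^-1` A `&` Y @^-1` B) * P C) ->
  forall D : set (R * R), measurable D ->
    P ((fun w => (X w, Y w)) @^-1` D `&` C)
    = P C * (distribution P X \x distribution P Y) D.
Proof.
move=> mC indXY indC D mD.
have mpre (A B : set R) : measurable A -> measurable B ->
    measurable (X @^-1` A `&` Y @^-1` B).
  by move=> mA mB; apply: measurableI; exact: measurable_funPTI.
pose XY := fun w : Omega => (X w, Y w).
have mXY : measurable_fun setT XY by exact/measurable_fun_pairP.
have mXYD : measurable (XY @^-1` D) by rewrite -[X in measurable X]setTI; exact: mXY.
have [PC0|PC0] := eqVneq (P C) 0.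
  rewrite PC0 mul0e; apply/eqP; rewrite eq_le measure_ge0 andbT -PC0.
  by apply: le_measure; rewrite ?inE//; exact: measurableI.
have PCfin : P C \is a fin_num by rewrite fin_num_measure.
have c0 : (0 <= (fine (P C))^-1)%R by rewrite invr_ge0 fine_ge0.
pose mXYC : {measure set (R * R) -> \bar R} :=
  mscale (NngNum c0) (pushforward (mrestr P mC) XY).
pose m' := mXYC mXY.
have m'E (E : set (R * R)) : m' E = (fine (P C))^-1%:E * P (XY @^-1` E `&` C) by [].
rewrite (@product_measure_unique _ _ _ _ _ _ _ m')//.
  rewrite m'E muleA -[X in X * _ * _]fineK// -EFinM divff ?mul1e//.
  by rewrite fine_eq0.
move=> A B mA mB; rewrite m'E.
rewrite -[XY @^-1` _]/(X @^-1` A `&` Y @^-1` B) indC// indXY//.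
rewrite muleC -muleA -[X in _ * (X * _)]fineK// -EFinM divff ?mule1//.
by rewrite fine_eq0.
Qed.

End independent_pair.

(** * Processes driven by independent inputs *)

Section driven_process.
Local Open Scope ereal_scope.
Context d (Omega : measurableType d) (R : realType) (P : probability Omega R).
Variables (Z : nat -> {RV P >-> R}) (s0 : R) (h : nat -> R * R -> R).
Hypothesis mh : forall n, measurable_fun setT (h n).

Fixpoint driven (n : nat) (w : Omega) : R :=
  if n is m.+1 then h m (driven m w, Z m w) else s0.

Lemma measurable_driven n : measurable_fun setT (driven n).
Proof.
elim: n => [|n IHn]; first exact: measurable_cst.
apply: (measurableT_comp (mh n)); exact/measurable_fun_pairP.
Qed.

(** The state with its measurability attached, as required to speak of its
    law. *)
Definition driven_RV n : {RV P >-> R} :=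
  mfun_Sub (mem_set (measurable_driven n)).

Hypothesis indepZ : mutually_independent Z.

(** A constraint on finitely many inputs; these are the events whose
    probability the mutual independence of [Z] determines. *)
Let cylinder (J : seq nat) (B : nat -> set R) : set Omega :=
  \bigcap_(i in [set` J]) (Z i @^-1` B i).

Let measurable_cylinder J B : (forall i, measurable (B i)) ->
  measurable (cylinder J B).
Proof.
move=> mB; apply: fin_bigcap_measurable => // i _; exact: measurable_funPTI.
Qed.

Let cylinder_cons n J B A : n \notin J ->
  Z n @^-1` A `&` cylinder J B =
  cylinder (n :: J) (fun i => if i == n then A else B i).
Proof.
move=> nJ; apply/seteqP; split=> [w [/= Aw Bw] i /=|w /= Bw].
- rewrite inE => /predU1P[->|iJ]; rewrite /preimage/= ?eqxx//.
  case: eqP => [iEn|_]; last exact: Bw.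
  by move: nJ; rewrite -iEn iJ.
- split=> [|i /= iJ].
    by have := Bw n (mem_head n J); rewrite /preimage/= eqxx.
  have : i \in n :: J by rewrite inE iJ orbT.
  move=> /(Bw i); rewrite /preimage/=; case: eqP => // iEn.
  by move: nJ; rewrite -iEn iJ.
Qed.

(** The state at time [n] is a function of the inputs of index less than [n].
    The induction treats the pair formed by the state and the input [Z n] in
    front of the later inputs, which is the situation of
    [independent_pair_law]. *)
Lemma driven_independent n (J : seq nat) (B : nat -> set R) (A : set R) :
  uniq J -> all (leq n) J -> (forall i, measurable (B i)) -> measurable A ->
  P (driven n @^-1` A `&` cylinder J B) =
  P (driven n @^-1` A) * P (cylinder J B).
Proof.
elim: n J B A => [|n IHn] J B A uJ nJ mB mA.
  rewrite /preimage/=; have [sA|sA] := boolP (s0 \in A).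
    have -> : [set _ : Omega | A s0] = setT.
      by apply/seteqP; split=> // w _ /=; exact/set_mem.
    by rewrite setTI probability_setT mul1e.
  have -> : [set _ : Omega | A s0] = set0.
    by apply/seteqP; split=> // w /= As; move/negP: sA; apply; exact/mem_set.
  by rewrite set0I measure0 mul0e.
have nnJ : n \notin J.
  by apply/negP => nJ'; move/allP: nJ => /(_ _ nJ'); rewrite ltnn.
have leJ : all (leq n) J by apply: sub_all nJ => i; exact: ltnW.
have mC := measurable_cylinder J mB.
have cyl0 C : cylinder [::] C = setT.
  by apply/seteqP; split=> // w _ i /=.
have cyl1 E : cylinder [:: n] (fun i => if i == n then E else setT) = Z n @^-1` E.
  by rewrite -(@cylinder_cons _ [::])// cyl0 setIT.
have mif C E : measurable E -> (forall i, measurable (C i)) ->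
    forall i, measurable (if i == n then E else C i : set R).
  by move=> mE mC' i; case: ifP.
have indXY A1 B1 : measurable A1 -> measurable B1 ->
    P (driven n @^-1` A1 `&` Z n @^-1` B1) = P (driven n @^-1` A1) * P (Z n @^-1` B1).
  move=> mA1 mB1; rewrite -cyl1 IHn//= ?leqnn//; exact: mif.
have indZ B1 : measurable B1 ->
    P (Z n @^-1` B1 `&` cylinder J B) = P (Z n @^-1` B1) * P (cylinder J B).
  move=> mB1; rewrite cylinder_cons// /cylinder !indepZ//=; last 2 first.
    by rewrite nnJ.
    exact: mif.
  rewrite big_cons eqxx; congr (_ * _); apply: eq_big_seq => i iJ.
  by case: eqP => // iEn; move: nnJ; rewrite -iEn iJ.
have indC A1 B1 : measurable A1 -> measurable B1 ->
    P (driven n @^-1` A1 `&` Z n @^-1` B1 `&` cylinder J B) =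
    P (driven n @^-1` A1 `&` Z n @^-1` B1) * P (cylinder J B).
  move=> mA1 mB1; rewrite -setIA indXY// -muleA -indZ//.
  rewrite cylinder_cons// IHn//=; first by rewrite nnJ.
    by rewrite leqnn.
  exact: mif.
have mhA : measurable (h n @^-1` A) by rewrite -[X in measurable X]setTI; exact: mh.
have law := @independent_pair_law _ _ _ P (driven_RV n) (Z n) _ _ indXY.
have indT A1 B1 : measurable A1 -> measurable B1 ->
    P (driven n @^-1` A1 `&` Z n @^-1` B1 `&` setT) =
    P (driven n @^-1` A1 `&` Z n @^-1` B1) * P setT.
  by move=> mA1 mB1; rewrite setIT probability_setT mule1.
have := law _ measurableT indT _ mhA; rewrite probability_setT mul1e setIT.
have := law _ mC indC _ mhA; rewrite muleC => hC hT.
by rewrite -[driven n.+1]/(h n \o (fun w => (driven_RV n w, Z n w))) comp_preimage hC hT.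
Qed.

(** Fubini's theorem for the state and the next input, which are independent. *)
Lemma driven_pair_integral n (f : R * R -> \bar R) :
  measurable_fun setT f -> (forall x, 0 <= f x) ->
  \int[P]_w f (driven n w, Z n w) =
  \int[P]_w \int[distribution P (Z n)]_z f (driven n w, z).
Proof.
move=> mf f0.
have mpair : measurable_fun setT (fun w => (driven n w, Z n w)).
  by apply/measurable_fun_pairP; split => //; exact: measurable_driven.
pose XY : {RV P >-> (R * R)%type} := mfun_Sub (mem_set mpair).
transitivity (\int[distribution P XY]_x f x).
  by rewrite ge0_integral_distribution.
transitivity (\int[distribution P (driven_RV n) \x distribution P (Z n)]_x f x).
  apply: eq_measure_integral => D mD _.
  have indT A B : measurable A -> measurable B ->
      P (driven_RV n @^-1` A `&` Z n @^-1` B) =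
      P (driven_RV n @^-1` A) * P (Z n @^-1` B).
    move=> mA mB; have := @driven_independent n [:: n] (fun=> B) A.
    rewrite /= leqnn /cylinder (_ : [set` [:: n]] = [set n]) ?bigcap_set1; first exact.
    by apply/seteqP; split=> i /=; rewrite inE => /eqP.
  have := independent_pair_law measurableT indT _ mD.
  rewrite probability_setT mul1e setIT; apply.
  by move=> A B mA mB; rewrite setIT mule1.
rewrite fubini_tonelli1//= /fubini_F ge0_integral_distribution//.
- exact: measurable_fun_fubini_tonelli_F.
- by move=> y; exact: integral_ge0.
Qed.

End driven_process.

(** * A maximal inequality for products of independent factors *)

Section maximal_inequality.
Local Open Scope ereal_scope.
Context d (Omega : measurableType d) (R : realType) (P : probability Omega R).
Variables (Z : nat -> {RV P >-> R}) (v : nat -> R -> R).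
Hypothesis indepZ : mutually_independent Z.
Hypothesis mv : forall i, measurable_fun setT (v i).
Hypothesis v_ge0 : forall i z, (0 <= v i z)%R.
Hypothesis mean1 : forall i, \int[distribution P (Z i)]_z (v i z)%:E = 1.

(** One step of the product [s * v 0 z0 * v 1 z1 * ...], frozen as soon as it
    has reached the level [c]. *)
Definition stopped_step (c : R) (n : nat) (sz : R * R) : R :=
  if (c <= sz.1)%R then sz.1 else (sz.1 * v n sz.2)%R.

Notation stopped c := (driven Z 1 (stopped_step c)).

Lemma measurable_stopped_step c n : measurable_fun setT (stopped_step c n).
Proof.
apply: measurable_fun_ifT => /=.
- by apply: measurable_fun_ler => //; exact: measurable_fst.
- exact: measurable_fst.
- apply: measurable_funM; first exact: measurable_fst.
  by apply: measurableT_comp => //; exact: measurable_snd.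
Qed.

Lemma stopped_ge0 c n w : (0 <= stopped c n w)%R.
Proof.
elim: n => [|n IHn] /=; first exact: ler01.
by rewrite /stopped_step; case: ifP => //= _; rewrite mulr_ge0.
Qed.

(** Whether the state is frozen or not, the conditional mean of the next state
    is the present one. *)
Lemma integral_stopped c n : \int[P]_w (stopped c n w)%:E = 1.
Proof.
elim: n => [|n IHn] /=; first by rewrite integral_cst//= probability_setT mul1e.
have mS := measurable_stopped_step c.
(* The integrand must be nonnegative everywhere, also at states that are never
   visited. *)
pose f (sz : R * R) : \bar R := (Num.max 0 (stopped_step c n sz))%:E.
have fE w : (stopped_step c n (stopped c n w, Z n w))%:E = f (stopped c n w, Z n w).
  by rewrite /f max_r//; exact: (stopped_ge0 c n.+1).
under eq_integral do rewrite fE.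
rewrite (driven_pair_integral 1 mS indepZ n (f := f)).
- rewrite -[RHS]IHn; apply: eq_integral => w _; rewrite /f /stopped_step/=.
  have s0 := stopped_ge0 c n w.
  have [cs|cs] := leP c (stopped c n w).
    rewrite (eq_integral (fun=> (stopped c n w)%:E)).
      by rewrite integral_cst//= probability_setT mule1.
    by move=> z _; rewrite max_r.
  rewrite (eq_integral (fun z => (stopped c n w)%:E * (v n z)%:E)); last first.
    by move=> z _; rewrite -EFinM max_r// mulr_ge0.
  rewrite ge0_integralZl//=; first by rewrite mean1 mule1.
  + exact/measurable_EFinP.
  + by move=> z _; rewrite lee_fin.
- apply/measurable_EFinP; apply: measurable_maxr => //; exact: mS.
- by move=> x; rewrite lee_fin le_max lexx.
Qed.

(** Freezing records in the final state whether the level was ever reached;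
    so the crossing event is determined by a single random variable. *)
Lemma stopped_crossing c N :
  [set w | exists2 n, (n <= N)%N & (c <= \prod_(i < n) v i (Z i w))%R] =
  [set w | (c <= stopped c N w)%R].
Proof.
have stay w n m : (n <= m)%N -> (c <= stopped c n w)%R ->
    stopped c m w = stopped c n w.
  elim: m => [|m IHm]; first by rewrite leqn0 => /eqP ->.
  rewrite leq_eqVlt => /predU1P[->//|/IHm{}IHm] cn.
  by rewrite /= /stopped_step/= IHm// cn.
have visit w n : exists2 m, (m <= n)%N &
    stopped c n w = (\prod_(i < m) v i (Z i w))%R /\
    ((stopped c n w < c)%R -> m = n).
  elim: n => [|n [m mn [Sm mnE]]]; first by exists 0%N => //; rewrite big_ord0.
  rewrite /= /stopped_step/=; have [cn|cn] := leP c (stopped c n w).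
    by exists m; [exact: leqW|split=> //; rewrite ltNge cn].
  exists n.+1 => //; split=> //; rewrite big_ord_recr/=; congr (_ * _)%R.
  by rewrite Sm mnE.
apply/seteqP; split=> w /=.
- move=> [n nN cn]; have [m mn [Sm mnE]] := visit w n.
  have cS : (c <= stopped c n w)%R.
    by rewrite leNgt; apply/negP => /[dup] Sc /mnE mE; move: Sc; rewrite Sm mE ltNge cn.
  by rewrite (stay _ _ _ nN cS).
- by have [m mN [-> _]] := visit w N; exists m.
Qed.

Lemma measurable_crossing N c : measurable
  [set w | exists2 n, (n <= N)%N & (c <= \prod_(i < n) v i (Z i w))%R].
Proof.
rewrite stopped_crossing; apply: measurable_le_set; first exact: measurable_cst.
exact: measurable_driven (measurable_stopped_step _) _.
Qed.

(** Ville's inequality for a product martingale: Markov's inequality for the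
    frozen product, of mean one. *)
Lemma product_maximal_inequality N c : (0 < c)%R ->
  P [set w | exists2 n, (n <= N)%N & (c <= \prod_(i < n) v i (Z i w))%R]
  <= (c^-1)%:E.
Proof.
move=> c0; rewrite stopped_crossing.
have mS := measurable_stopped_step c.
have := @markov _ _ _ P (driven_RV Z 1 mS N) id c c0.
rewrite -[(c^-1)%:E]mul1e lee_pdivlMr// muleC.
move=> /(_ (@measurable_id _ _ _)) /(_ (fun r r0 => r0)) /(_ (fun x y _ _ xy => xy)).
rewrite unlock.
rewrite (eq_integral (fun w => (stopped c N w)%:E)); last first.
  by move=> w _ /=; rewrite ger0_norm// stopped_ge0.
rewrite integral_stopped; apply: le_trans; rewrite le_eqVlt; apply/predU1P; left.
rewrite [X in P X * _ = _](_ : _ =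
    [set x | c%:E <= `|(driven_RV Z 1 mS N x)%:E|])//.
by apply/seteqP; split=> w /=; rewrite lee_fin ger0_norm// stopped_ge0.
Qed.

End maximal_inequality.

(** * Deviations of the accumulated gap between two arms *)

(** The left inverse [g] transports to [I] the family of sets indexed by
    [I']. *)
Lemma mutually_independent_reindex d (Omega : measurableType d) (R : realType)
    (P : probability Omega R) (I I' : choiceType) (X : I -> {RV P >-> R})
    (f : I' -> I) (g : I -> I') :
  cancel f g -> mutually_independent X -> mutually_independent (fun i => X (f i)).
Proof.
move=> fK indX J B uJ mB.
have uJ' : uniq (map f J) by rewrite map_inj_uniq//; exact: can_inj fK.
have := indX (map f J) (fun i => B (g i)) uJ' (fun i => mB (g i)).
rewrite big_map; under eq_bigr do rewrite fK.
move=> <-; congr (P _); apply/seteqP; split=> w /= Xw i.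
  by move=> /= /mapP[j jJ ->]; rewrite fK; exact: Xw.
by move=> /= iJ; have := Xw (f i) (map_f f iJ); rewrite /= fK.
Qed.

Section gap_deviation.
Context d (Omega : measurableType d) (R : realType) (P : probability Omega R).
Variables (mu : 'I_2 -> R) (Y : 'I_2 * nat -> {RV P >-> R}).
Hypothesis bandit : gaussian_bandit mu Y.
Variables (a b : 'I_2).
Hypothesis ab : a != b.

Definition gap_sum (y : 'I_2 * nat -> R) (n : nat) : R :=
  \sum_(k < n) (y (b, val k) - y (a, val k)).

(** The two reward streams merged into one, so that each factor of the
    exponential process depends on a single reward. *)
Let pull (i : nat) : 'I_2 * nat := (if odd i then a else b, i./2).

Let pullK : cancel pull (fun xk => ((xk.1 == a) + xk.2.*2)%N).
Proof.
move=> i; rewrite /pull/=; case: ifPn => oi.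
  by rewrite eqxx -[RHS]odd_double_half oi.
by rewrite eq_sym (negbTE ab) -[RHS]odd_double_half (negbTE oi).
Qed.

(** Rewards of arm [a] enter with the tilt [lam], those of arm [b] with
    [- lam]. *)
Let factor (lam : R) (i : nat) (z : R) : R :=
  let e := if odd i then lam else - lam in
  expR (e * (z - mu (pull i).1) - e ^+ 2 / 2).

(** Each pull costs [lam^2 / 2], hence the term [lam^2 n] for [n] pulls of each
    arm. *)
Let factor_prod lam n w :
  \prod_(i < n.*2) factor lam i (Y (pull i) w) =
  expR (lam * (n%:R * (mu b - mu a) - gap_sum (Y ^~ w) n) - lam ^+ 2 * n%:R).
Proof.
elim: n => [|n IHn].
  by rewrite big_ord0 /gap_sum big_ord0 !(mul0r, mulr0, subr0) expR0.
rewrite doubleS !big_ord_recr/= IHn /factor/= odd_double/= -!expRD.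
rewrite /pull/= odd_double/= uphalf_double doubleK.
by rewrite /gap_sum big_ord_recr/=; congr expR; rewrite -natr1; field.
Qed.

Definition gap_crossing lam x N : set Omega :=
  [set w | exists2 n, (n <= N)%N &
    x <= lam * (n%:R * (mu b - mu a) - gap_sum (Y ^~ w) n) - lam ^+ 2 * n%:R].

Lemma measurable_gap_sum n : measurable_fun setT (fun w => gap_sum (Y ^~ w) n).
Proof.
by apply: measurable_sum => k; exact: measurable_funB.
Qed.

Lemma measurable_gap_crossing lam x N : measurable (gap_crossing lam x N).
Proof.
have -> : gap_crossing lam x N = \bigcup_(n in [set n | (n <= N)%N]) 
   [set w | x <= lam * (n%:R * (mu b - mu a) - gap_sum (Y ^~ w) n) - lam ^+ 2 * n%:R].
  by apply/seteqP; split=> w [n nN xn]; exists n.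
apply: bigcup_measurable => n _.
apply: measurable_le_set; first exact: measurable_cst.
apply: measurable_funB => //; apply: measurable_funM => //.
by apply: measurable_funB => //; exact: measurable_gap_sum.
Qed.

(** The first [2 n] factors multiply to the exponential of the tilted gap
    ([factor_prod]), and each has mean one ([normal_law_tilt]). *)
Lemma gap_crossing_prob lam x N : (P (gap_crossing lam x N) <= (expR (- x))%:E)%E.
Proof.
have [indY lawY] := bandit.
have indZ := mutually_independent_reindex pullK indY.
have mfac i : measurable_fun setT (factor lam i).
  apply: measurableT_comp => //; apply: measurable_funB => //.
  by apply: measurable_funM => //; exact: measurable_funB.
have fac0 i z : 0 <= factor lam i z by exact: expR_ge0.
have fac1 i : (\int[distribution P (Y (pull i))]_z (factor lam i z)%:E = 1)%E.
  by apply: normal_law_tilt => B mB; case: (pull i) => i0 k; exact: lawY.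
have := @product_maximal_inequality _ _ _ _ _ _ indZ mfac fac0 fac1 N.*2 _ (expR_gt0 x).
rewrite -expRN; apply: le_trans; apply: le_measure; rewrite ?inE.
- exact: measurable_gap_crossing.
- exact: (@measurable_crossing _ _ _ P (fun i => Y (pull i)) _ mfac).
- move=> w [n nN xn]; exists n.*2; first by rewrite leq_double.
  by rewrite factor_prod ler_expR.
Qed.

End gap_deviation.

(** * Paths of the algorithm *)

Section policy.
Context (R : realType) (T : nat).
Implicit Type y : 'I_2 * nat -> R.

Lemma arm_cases (i : 'I_2) : i = arm1 \/ i = arm2.
Proof. by case: i => -[|[|//]] i; [left|right]; apply: val_inj. Qed.

(** In case of a tie, the first arm of the enumeration is chosen; the exact
    form is used for measurability. *)
Lemma best_armE y n : best_arm y n =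
  if empirical_mean y arm2 n <= empirical_mean y arm1 n then arm1 else arm2.
Proof.
have geqE i : [forall (j | true), empirical_mean y j n <= empirical_mean y i n]
    = (empirical_mean y arm1 n <= empirical_mean y i n) &&
      (empirical_mean y arm2 n <= empirical_mean y i n).
  apply/forallP/andP => [h|[h1 h2] j]; first by split; [exact: (h arm1)|exact: (h arm2)].
  by have [->|->] := arm_cases j.
rewrite /best_arm /Order.arg_max /extremum /pick /enum_mem -enumT.
have -> : enum 'I_2 = [:: arm1; arm2].
  rewrite !enum_ordSl enum_ord0/=; congr [:: _; _]; exact: val_inj.
rewrite /= !inE/= !geqE lexx/=.
case: ifP => //= h; case: ifP => //=; rewrite lexx andbT => /negbT.
by rewrite -ltNge => /ltW; rewrite h.
Qed.

Definition explore (t : nat) : 'I_2 := if odd t then arm1 else arm2.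

Lemma explore_count (a : 'I_2) N :
  (\sum_(1 <= t < N.+1) (explore t == a) <= uphalf N)%N.
Proof.
have main : (\sum_(1 <= t < N.+1) (explore t == a) =
    if a == arm1 then uphalf N else N./2)%N.
  elim: N => [|N IHN]; first by rewrite big_geq//; case: ifP.
  rewrite big_nat_recr//= IHN /explore/=.
  rewrite uphalf_half; have [->|->] := arm_cases a; case: (odd N) => /=;
    rewrite ?addn0 ?add0n ?addn1 ?add1n//.
by rewrite main; case: ifP => // _; rewrite uphalf_half leq_addl.
Qed.

Lemma gap_sumE y (b a : 'I_2) n :
  gap_sum a b y n = n%:R * (empirical_mean y b n - empirical_mean y a n).
Proof.
rewrite /gap_sum /empirical_mean sumrB.
have [->|n0] := eqVneq n 0%N; first by rewrite !big_ord0 mul0r subr0.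
by rewrite mulrBr !mulrA ![n%:R * _]mulrC !mulfK// pnatr_eq0.
Qed.

Lemma norm_gap_sum y (b a : 'I_2) n : a != b ->
  `|gap_sum a b y n| =
  n%:R * `|empirical_mean y arm1 n - empirical_mean y arm2 n|.
Proof.
move=> ab; rewrite gap_sumE normrM ger0_norm//; move: ab.
have [->|->] := arm_cases a; have [->|->] := arm_cases b; rewrite ?eqxx// => _.
by rewrite distrC.
Qed.

(** Specification of the head of the filtered list that encodes the stopping
    time. *)
Lemma first_stopP (p : pred nat) k m :
  match ohead [seq (2 * n)%N | n <- iota k m & p n] with
  | Some s => exists n, [/\ s = (2 * n)%N, (k <= n < k + m)%N, p n &
                         forall j, (k <= j < n)%N -> ~~ p j]
  | None => forall j, (k <= j < k + m)%N -> ~~ p j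
  end.
Proof.
elim: m k => [|m IHm] k /=; first by move=> j; rewrite addn0 ltnNge; case: leqP.
case: ifPn => pk /=.
  exists k; split=> // [|j]; first by rewrite leqnn -addSnnS leq_addr.
  by rewrite ltnNge; case: leqP.
have ge j : (k <= j)%N -> ~~ p j \/ (k.+1 <= j)%N.
  by rewrite leq_eqVlt => /predU1P[<-|]; [left|right].
have := IHm k.+1; case: ohead => [s [n [-> /andP[kn nm] pn np]]|np].
  exists n; split=> //; first by rewrite (ltnW kn) -addSnnS.
  by move=> j /andP[/ge[//|kj] jn]; apply: np; rewrite kj.
by move=> j /andP[/ge[//|kj] jm]; apply: np; rewrite kj addSnnS.
Qed.

(** At [n = 0] both sides of the test are [0], since division by zero yields
    zero; so the sums over [m] below count [m = 0] as a failed test. *)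
Lemma stops_after0 y : stops_after T y 0 = false.
Proof.
by rewrite /stops_after /threshold /empirical_mean invr0 !mulr0 subrr normr0 sqrtr0 ltxx.
Qed.

Definition pulls (a : 'I_2) y : nat :=
  (\sum_(1 <= t < T.+1) (bai_etc T y t == a))%N.

(** Some passed test points to the arm [a]. This event contains the wrong
    recommendation of [a] and does not refer to the stopping time. *)
Definition wrong_stop (a b : 'I_2) y : bool :=
  has (fun n => stops_after T y n && (gap_sum a b y n < 0)) (iota 1 T./2).

Lemma best_arm_wrong y n (a b : 'I_2) : a != b -> (0 < n)%N ->
  stops_after T y n -> best_arm y n = a -> gap_sum a b y n < 0.
Proof.
move=> ab n0 st ba; rewrite gap_sumE pmulr_rlt0 ?ltr0n// subr_lt0.
have ne : empirical_mean y arm1 n != empirical_mean y arm2 n.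
  apply/eqP => e; move: st; rewrite /stops_after e subrr normr0.
  by rewrite ltNge sqrtr_ge0.
move: ba ab; rewrite best_armE; case: ifPn => [le21|]; last first.
  by rewrite -ltNge => lt12 <-; have [->|->] := arm_cases b; rewrite ?eqxx.
move=> <-; have [->|->] := arm_cases b; rewrite ?eqxx// => _.
by rewrite lt_neqAle eq_sym ne.
Qed.

(** A run that stops after [n] pairs explores [a] exactly [n] times, and all
    tests before [n] have failed. After the exploration, [a] is played only if
    the test pointed to it. Without a stop, [a] is pulled at most
    [T/2 + 1] times, which the summand [m = T/2] covers for odd [T]. *)
Lemma pulls_le y (a b : 'I_2) : a != b ->
  (pulls a y <= \sum_(m < T./2.+1) ~~ stops_after T y m + T * wrong_stop a b y)%N.
Proof.
move=> ab; rewrite /pulls /bai_etc.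
have := first_stopP (stops_after T y) 1 T./2; rewrite -/(tau T y).
case: (tau T y) => [s [n [-> /andP[n0 nT] stn nst]]|nst].
- have n2T : (2 * n <= T)%N.
    rewrite -(odd_double_half T) mul2n; apply: leq_trans (leq_addl _ _).
    by rewrite leq_double -ltnS.
  rewrite (@big_cat_nat _ _ _ (2 * n).+1)//= ?ltnS//; apply: leq_add.
    apply: (@leq_trans n).
      have := explore_count a (2 * n); rewrite mul2n uphalf_double.
      apply: leq_trans; apply: eq_leq; apply: eq_big_nat => t /andP[_].
      by rewrite ltnS => ->.
    rewrite -(big_mkord xpredT (fun m => nat_of_bool (~~ stops_after T y m))).
    rewrite (@big_cat_nat _ _ _ n)//=; last by rewrite -ltnS ltnW.
    apply: leq_trans (leq_addr _ _).
    rewrite (eq_big_nat _ _ (F2 := fun=> 1%N)).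
      by rewrite sum_nat_const_nat muln1 subn0.
    move=> m /andP[_ mn]; case: (posnP m) => [->|m0]; first by rewrite stops_after0.
    by rewrite nst// m0.
  have [ba|ba] := eqVneq (best_arm y n) a; last first.
    rewrite big_nat_cond big1// => t; rewrite andbT => /andP[tn _].
    by rewrite leqNgt tn/= mul2n doubleK (negbTE ba).
  have -> : wrong_stop a b y.
    apply/hasP; exists n; first by rewrite mem_iota n0.
    by rewrite stn (best_arm_wrong ab).
  rewrite muln1; apply: (@leq_trans (\sum_((2 * n).+1 <= t < T.+1) 1)).
    by apply: leq_sum => t _; exact: leq_b1.
  by rewrite sum_nat_const_nat muln1 subSS leq_subr.
- apply: leq_trans (leq_addr _ _).
  apply: leq_trans (explore_count a T) _.
  rewrite (eq_bigr (fun=> 1%N)) ?sum1_card ?card_ord; last first.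
    move=> m _; case: (posnP m) => [->|m0]; first by rewrite stops_after0.
    by rewrite nst// m0 add1n ltn_ord.
  by rewrite uphalf_half -addn1 addnC leq_add2l leq_b1.
Qed.

End policy.

(** * Decomposition of the regret *)

Section list_events.
Context d (Omega : measurableType d).

Lemma measurable_has (s : seq nat) (p : nat -> Omega -> bool) :
  (forall n, measurable [set w | p n w]) ->
  measurable [set w | has (p ^~ w) s].
Proof.
move=> mp; elim: s => [|n s IHs].
  by rewrite (_ : [set w | _] = set0)//; apply/seteqP; split.
rewrite (_ : [set w | _] = [set w | p n w] `|` [set w | has (p ^~ w) s]).
  exact: measurableU.
by apply/seteqP; split=> w /=; [move/orP|move=> h; apply/orP].
Qed.

(** The head of a filtered list takes finitely many values, each decided by
    finitely many measurable tests. *)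
Lemma measurable_ohead (s : seq nat) (p : nat -> Omega -> bool)
    (f : nat -> nat) (q : option nat -> Omega -> bool) :
  (forall n, measurable [set w | p n w]) ->
  (forall o, measurable [set w | q o w]) ->
  measurable [set w | q (ohead [seq f n | n <- s & p n w]) w].
Proof.
move=> mp mq; elim: s => [|n s IHs] //=.
rewrite (_ : [set w | _] = ([set w | p n w] `&` [set w | q (Some (f n)) w]) `|`
   ((~` [set w | p n w]) `&` [set w | q (ohead [seq f n | n <- s & p n w]) w])).
  by apply: measurableU; apply: measurableI => //; exact: measurableC.
apply/seteqP; split=> w /=; case: (p n w) => /=; [by left|by right| |].
- by case=> -[].
- by case=> -[].
Qed.

End list_events.

Section regret_decomposition.
Context d (Omega : measurableType d) (R : realType) (P : probability Omega R).
Variables (mu : 'I_2 -> R) (Y : 'I_2 * nat -> {RV P >-> R}) (T : nat).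

Lemma measurable_empirical_mean i n :
  measurable_fun setT (fun w => empirical_mean (Y ^~ w) i n).
Proof. by apply: measurable_funM => //; apply: measurable_sum. Qed.

Lemma measurable_stops_after n : measurable [set w | stops_after T (Y ^~ w) n].
Proof.
apply: measurable_lt_set => //; apply: measurableT_comp => //.
by apply: measurable_funB; exact: measurable_empirical_mean.
Qed.

Lemma measurable_best_arm n a : measurable [set w | best_arm (Y ^~ w) n == a].
Proof.
have m21 := measurable_le_set (measurable_empirical_mean arm2 n)
  (measurable_empirical_mean arm1 n).
have [->|->] := arm_cases a.
  rewrite (_ : [set w | _] = [set w | empirical_mean (Y ^~ w) arm2 n <=
    empirical_mean (Y ^~ w) arm1 n])//.
  by apply/seteqP; split=> w /=; rewrite best_armE; case: ifP.
rewrite (_ : [set w | _] = ~` [set w | empirical_mean (Y ^~ w) arm2 n <=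
    empirical_mean (Y ^~ w) arm1 n]); first exact: measurableC.
by apply/seteqP; split=> w /=; rewrite best_armE; case: ifP.
Qed.

Lemma measurable_bai_etc t a : measurable [set w | bai_etc T (Y ^~ w) t == a].
Proof.
have mB (c : bool) : measurable [set _ : Omega | c].
  case: c; first by rewrite (_ : [set _ | _] = setT)//; apply/seteqP; split.
  by rewrite (_ : [set _ | _] = set0)//; apply/seteqP; split.
pose q o (w : Omega) := (if o is Some s then
    if (t <= s)%N then explore t else best_arm (Y ^~ w) s./2
  else explore t) == a.
apply: (@measurable_ohead _ _ (iota 1 T./2) (fun n w => stops_after T (Y ^~ w) n)
  (fun n => (2 * n)%N) q); first exact: measurable_stops_after.
case=> [s|]; last exact: mB.
rewrite /q; case: leqP => _; [exact: mB|exact: measurable_best_arm].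
Qed.

Lemma measurable_wrong_stop a b : measurable [set w | wrong_stop T a b (Y ^~ w)].
Proof.
apply: (@measurable_has _ _ _ (fun n w => stops_after T (Y ^~ w) n &&
  (gap_sum a b (Y ^~ w) n < 0))) => n.
rewrite (_ : [set w | _] = [set w | stops_after T (Y ^~ w) n] `&`
  [set w | gap_sum a b (Y ^~ w) n < 0]).
  apply: measurableI; first exact: measurable_stops_after.
  by apply: measurable_lt_set => //; exact: measurable_gap_sum.
by apply/seteqP; split=> w /=; [move/andP|move=> h; apply/andP].
Qed.

Lemma indicB (p : Omega -> bool) w : (p w)%:R = \1_[set w | p w] w :> R.
Proof.
rewrite indicE; case: (boolP (p w)) => pw; first by rewrite mem_set.
by rewrite memNset//; exact/negP.
Qed.

Lemma pulls_le_horizon a (y : 'I_2 * nat -> R) : (pulls T a y <= T)%N.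
Proof.
apply: (@leq_trans (\sum_(1 <= t < T.+1) 1)).
  by apply: leq_sum => t _; exact: leq_b1.
by rewrite sum_nat_const_nat muln1 subn1.
Qed.

Let N (a : 'I_2) w : R := (pulls T a (Y ^~ w))%:R.

Let NE a w : N a w = \sum_(1 <= t < T.+1) \1_[set w | bai_etc T (Y ^~ w) t == a] w.
Proof.
rewrite /N /pulls natr_sum; apply: eq_bigr => t _.
exact: (indicB (fun w => bai_etc T (Y ^~ w) t == a)).
Qed.

Let measurable_N a : measurable_fun setT (N a).
Proof.
rewrite (_ : N a = fun w =>
  \sum_(1 <= t < T.+1) \1_[set w | bai_etc T (Y ^~ w) t == a] w); last exact/funext.
by apply: measurable_sum => t; apply: measurable_indic; exact: measurable_bai_etc.
Qed.

(** Only pulls of the worse arm cost, and each costs the difference of the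
    means. *)
Lemma regretE (a b : 'I_2) : a != b -> mu a <= mu b ->
  regret P mu T (fun t w => bai_etc T (Y ^~ w) t) =
  (\int[P]_w ((mu b - mu a) * (pulls T a (Y ^~ w))%:R)%:E)%E.
Proof.
move=> ab mab; set D := mu b - mu a.
have D0 : 0 <= D by rewrite subr_ge0.
have maxE : Num.max (mu arm1) (mu arm2) = mu b.
  move: ab mab; have [->|->] := arm_cases a; have [->|->] := arm_cases b;
    rewrite ?eqxx// => _ h; [exact: max_r|exact: max_l].
have AE w : \sum_(1 <= t < T.+1) mu (bai_etc T (Y ^~ w) t) = T%:R * mu b - D * N a w.
  rewrite NE mulr_sumr.
  rewrite (_ : T%:R * mu b = \sum_(1 <= t < T.+1) mu b); last first.
    by rewrite sumr_const_nat subn1 mulr_natl.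
  rewrite -sumrB; apply: eq_bigr => t _.
  rewrite -(indicB (fun w => bai_etc T (Y ^~ w) t == a)).
  have [->|Aa] := eqVneq (bai_etc T (Y ^~ w) t) a; first by rewrite mulr1 subKr.
  rewrite mulr0 subr0; congr mu; move: Aa ab.
  by have [->|->] := arm_cases (bai_etc T (Y ^~ w) t); have [->|->] := arm_cases a;
    have [->|->] := arm_cases b.
have intN : P.-integrable setT (fun w => (D * N a w)%:E).
  apply: measurable_bounded_integrable => //.
  - by rewrite (le_lt_trans (probability_le1 P measurableT)) ?ltry.
  - by apply: measurable_funM => //; exact: measurable_N.
  - exists (D * T%:R); split; first exact: num_real.
    move=> x xT w _ /=; rewrite ger0_norm ?mulr_ge0//; apply: le_trans (ltW xT).
    by rewrite ler_wpM2l// ler_nat pulls_le_horizon.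
rewrite /regret maxE unlock.
under eq_integral do rewrite AE.
rewrite integralB_EFin//; last exact: finite_measure_integrable_cst.
rewrite integral_cst//= probability_setT mule1.
have fN := integrable_fin_num measurableT intN.
by rewrite -(fineK fN) -!EFinB subKr.
Qed.

Lemma regret_le_horizon (a b : 'I_2) : a != b -> mu a <= mu b ->
  (regret P mu T (fun t w => bai_etc T (Y ^~ w) t) <= (T%:R * (mu b - mu a))%:E)%E.
Proof.
move=> ab mab; rewrite (regretE ab mab).
have D0 : 0 <= mu b - mu a by rewrite subr_ge0.
apply: (@le_trans _ _ (\int[P]_w (cst (T%:R * (mu b - mu a))%:E w))%E); last first.
  by rewrite integral_cst//= probability_setT mule1.
apply: ge0_le_integral => //=.
- by move=> w _; rewrite lee_fin mulr_ge0.
- by apply/measurable_EFinP; apply: measurable_funM => //; exact: measurable_N.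
- by move=> w _; rewrite lee_fin mulrC ler_wpM2r// ler_nat pulls_le_horizon.
Qed.

Lemma regret_le (a b : 'I_2) : a != b -> mu a <= mu b ->
  (regret P mu T (fun t w => bai_etc T (Y ^~ w) t) <=
   (mu b - mu a)%:E * (\sum_(m < T./2.+1) P (~` [set w | stops_after T (Y ^~ w) m])
      + T%:R%:E * P [set w | wrong_stop T a b (Y ^~ w)]))%E.
Proof.
move=> ab mab; rewrite (regretE ab mab); set D := mu b - mu a.
have D0 : 0 <= D by rewrite subr_ge0.
have mst m : measurable (~` [set w | stops_after T (Y ^~ w) m]).
  by apply: measurableC; exact: measurable_stops_after.
have mwr := measurable_wrong_stop a b.
pose B w : \bar R := (\sum_(m < T./2.+1) (\1_(~` [set w | stops_after T (Y ^~ w) m]) w)%:E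
  + T%:R%:E * (\1_[set w | wrong_stop T a b (Y ^~ w)] w)%:E)%E.
have B1m (m : 'I_(T./2.+1)) : measurable_fun setT
    (fun w => (\1_(~` [set w | stops_after T (Y ^~ w) m]) w : R)%:E).
  by apply/measurable_EFinP; exact: measurable_indic.
have B2m : measurable_fun setT
    (fun w => T%:R%:E * (\1_[set w | wrong_stop T a b (Y ^~ w)] w : R)%:E)%E.
  by apply/measurable_EFinP; apply: measurable_funM => //; exact: measurable_indic.
have -> : (D%:E * (\sum_(m < T./2.+1) P (~` [set w | stops_after T (Y ^~ w) m])
      + T%:R%:E * P [set w | wrong_stop T a b (Y ^~ w)]) = \int[P]_w (D%:E * B w))%E.
  rewrite ge0_integralZl//=; last 2 first.
  - by apply: emeasurable_funD => //; exact: emeasurable_sum.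
  - by move=> w _; rewrite adde_ge0// ?mule_ge0// ?lee_fin// sume_ge0.
  congr (_ * _)%E; rewrite ge0_integralD//=; last 2 first.
  - by move=> w _; rewrite sume_ge0// => m _; rewrite lee_fin.
  - exact: emeasurable_sum.
  rewrite ge0_integral_sum//; congr (_ + _)%E.
    by apply: eq_bigr => m _; rewrite integral_indic// setIT.
  rewrite ge0_integralZl//=; last by apply/measurable_EFinP; exact: measurable_indic.
  by rewrite integral_indic// setIT.
apply: ge0_le_integral => //=.
- by move=> w _; rewrite lee_fin mulr_ge0.
- by apply/measurable_EFinP; apply: measurable_funM => //; exact: measurable_N.
- apply: emeasurable_funM => //; apply: emeasurable_funD => //.
  exact: emeasurable_sum.
- move=> w _; rewrite EFinM lee_wpmul2l// /B sumEFin -EFinM -EFinD lee_fin.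
  have := pulls_le T (Y ^~ w) ab; rewrite -(ler_nat R) natrD natrM.
  rewrite [X in _ <= X + _]natr_sum -[X in X <= _]/(N a w).
  rewrite (indicB (fun w => wrong_stop T a b (Y ^~ w))).
  move=> /le_trans; apply; rewrite lerD2r; apply: ler_sum => m _.
  rewrite (indicB (fun w => ~~ stops_after T (Y ^~ w) m)).
  rewrite !indicE; case: (boolP (w \in _)) => //; rewrite inE/= => /negP h.
  by rewrite mem_set.
Qed.

End regret_decomposition.

(** * The exploration sum *)

Section exponential_bounds.
Context (R : realType).
Implicit Types x : R.

(** A partial sum of the exponential series, whose terms are nonnegative. *)
Lemma expR_ge_quad x : 0 <= x -> 1 + x + x ^+ 2 / 2 <= expR x.
Proof.
move=> x0; have -> : 1 + x + x ^+ 2 / 2 = series (exp_coeff x) 3.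
  rewrite /series/= !big_nat_recr//= big_geq// /exp_coeff/= !factS fact0.
  by rewrite add0r expr0 expr1 !divr1.
apply: nondecreasing_cvgn_le; last exact: is_cvg_series_exp_coeff.
by apply/nondecreasing_seqP => n; rewrite seriesS lerDr exp_coeff_ge0.
Qed.

Lemma expR1_le3 : expR 1 <= 3 :> R.
Proof.
have e6 : expR (6^-1) <= 6 / 5 :> R.
  have -> : 6 / 5 = (5 / 6)^-1 :> R by rewrite invf_div.
  rewrite -[leLHS]invrK -expRN lef_pV2 ?posrE ?expR_gt0////.
  by apply: le_trans (expR_ge1Dx _); lra.
rewrite (_ : expR 1 = expR (6%:R * 6^-1)); last by rewrite divff.
rewrite expRM_natl; apply: (@le_trans _ _ ((6 / 5) ^+ 6)); last by lra.
by rewrite lerXn2r ?nnegrE ?expR_ge0//; lra.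
Qed.

Lemma ln_le_sub1 x : 0 < x -> ln x <= x - 1.
Proof. by move=> x0; rewrite -[x in ln x](subrK 1) addrC le_ln1Dx//; lra. Qed.

Lemma ln_quarter_ge2 x : 4 * expR 1 ^+ 2 < x -> 2 <= ln (x / 4).
Proof.
move=> x4; have e2 : 0 < expR 1 ^+ 2 :> R by rewrite exprn_gt0// expR_gt0.
rewrite -[2]expRK ler_ln ?posrE ?expR_gt0//; last by lra.
by rewrite (_ : expR 2 = expR 1 ^+ 2); [lra|rewrite -expRM_natl mulr1].
Qed.

End exponential_bounds.

Section exploration_sum.
Context (R : realType).

(** Discrete form of the fact that [- (1 + u) exp (- u)] is a primitive of
    [u exp (- u)], and hence of [exp (- u)] with respect to [u^2 / 2]. *)
Lemma exploration_kernel (v w : R) : 0 <= v -> v <= w ->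
  1 + w + (w ^+ 2 - v ^+ 2) / 2 <= (1 + v) * expR (w - v).
Proof.
move=> v0 vw; have wv : 0 <= w - v by rewrite subr_ge0.
apply: (@le_trans _ _ ((1 + v) * (1 + (w - v) + (w - v) ^+ 2 / 2))).
  rewrite -subr_ge0.
  rewrite [X in 0 <= X](_ : _ = v * (w - v) ^+ 2 / 2); last by field.
  by rewrite divr_ge0// mulr_ge0// sqr_ge0.
by rewrite ler_wpM2l ?expR_ge_quad// addr_ge0.
Qed.

(** With [v = D sqrt m], consecutive values of [v^2] differ by [D^2], so that
    the tail is a sum of [exp (- v)] against increments of [v^2] and
    telescopes by [exploration_kernel]. The first [4 s^2 / D^2] terms are
    bounded by one each; the constant [2] accounts for rounding up and for the
    first term of the tail. *)
Lemma exploration_sum (D s : R) (K : nat) (f : nat -> R) :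
  0 < D -> 0 <= s -> (forall m, f m <= 1) ->
  (forall m, (m < K)%N -> 2 * s <= D * Num.sqrt m%:R ->
     f m <= expR (1 - (D * Num.sqrt m%:R - 2 * s))) ->
  \sum_(m < K) f m <= 4 * s ^+ 2 / D ^+ 2 + 2 + 6 * (1 + 2 * s) / D ^+ 2.
Proof.
move=> D0 s0 f1 ftail; set x0 := 4 * s ^+ 2 / D ^+ 2.
have D20 : 0 < D ^+ 2 by rewrite exprn_gt0.
pose v k : R := D * Num.sqrt k%:R.
have v_ge0 k : 0 <= v k by rewrite mulr_ge0 ?sqrtr_ge0// ltW.
have v2 k : v k ^+ 2 = D ^+ 2 * k%:R by rewrite exprMn sqr_sqrtr.
have vx0 k : (2 * s <= v k) = (x0 <= k%:R).
  have -> : (2 * s <= v k) = ((2 * s) ^+ 2 <= v k ^+ 2).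
    by rewrite ler_pXn2r ?nnegrE// mulr_ge0.
  rewrite v2 /x0 ler_pdivrMr// [k%:R * _]mulrC; congr (_ <= _); ring.
(* Primitive of the tail, up to sign. *)
pose G u := 2 * expR 1 / D ^+ 2 * ((1 + u) * expR (2 * s - u)).
have Gmono u1 u2 : 0 <= u1 -> u1 <= u2 ->
    (u2 ^+ 2 - u1 ^+ 2) / D ^+ 2 * expR (1 - (u2 - 2 * s)) <= G u1 - G u2.
  move=> u10 u12; have := exploration_kernel u10 u12.
  set X := expR (u2 - u1) => kX.
  have -> : expR (1 - (u2 - 2 * s)) = expR 1 * expR (2 * s - u2).
    by rewrite -expRD; congr expR; ring.
  rewrite /G (_ : expR (2 * s - u1) = expR (2 * s - u2) * X); last first.
    by rewrite -expRD; congr expR; ring.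
  rewrite -subr_ge0 [X in 0 <= X](_ : _ = 2 * expR 1 * expR (2 * s - u2) / D ^+ 2 *
    ((1 + u1) * X - (1 + u2 + (u2 ^+ 2 - u1 ^+ 2) / 2))); last first.
    by field; rewrite gt_eqF.
  rewrite mulr_ge0 ?subr_ge0// !mulr_ge0 ?expR_ge0// invr_ge0.
  exact: ltW.
have crude k : \sum_(m < k) f m <= k%:R.
  rewrite -[k in k%:R]card_ord -sum1_card natr_sum; exact: ler_sum.
have G0 u : 0 <= u -> 0 <= G u.
  move=> u0; rewrite /G !mulr_ge0 ?expR_ge0 ?invr_ge0 ?(ltW D20)// addr_ge0//.
have x00 : 0 <= x0 by apply: divr_ge0; rewrite ?mulr_ge0 ?sqr_ge0// ltW.
have Gs0 k : x0 <= k%:R -> 0 <= G (2 * s) - G (v k).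
  rewrite -vx0 => sv; apply: le_trans (Gmono _ _ _ sv); last by rewrite mulr_ge0.
  rewrite !mulr_ge0 ?expR_ge0 ?invr_ge0 ?(ltW D20)// subr_ge0 ler_pXn2r ?nnegrE//.
  by rewrite mulr_ge0.
have tail k : (k < K)%N -> x0 <= k%:R ->
    \sum_(m < k.+1) f m <= x0 + 2 + (G (2 * s) - G (v k)).
  elim: k => [|k IHk] kK xk.
    have := crude 1%N; have := Gs0 _ xk; lra.
  have [xk'|kx] := leP x0 k%:R.
    rewrite big_ord_recr/=; have := IHk (ltnW kK) xk'.
    have vk1 : v k <= v k.+1.
      by rewrite ler_wpM2l ?(ltW D0)// ler_sqrt// ler_nat.
    have := Gmono _ _ (v_ge0 k) vk1.
    rewrite !v2 -mulrBr -natrB// subSnn mulr1 divff ?gt_eqF// mul1r.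
    have : 2 * s <= v k.+1 by rewrite vx0.
    by move=> /(ftail _ kK); rewrite -/(v k.+1); lra.
  have := crude k.+2; rewrite -addn2 natrD; have := Gs0 _ xk; lra.
have GE : G (2 * s) <= 6 * (1 + 2 * s) / D ^+ 2.
  rewrite /G subrr expR0 mulr1 mulrAC ler_pM2r ?invr_gt0//.
  rewrite ler_wpM2r ?addr_ge0 ?mulr_ge0//; have := expR1_le3 R; lra.
clear ftail; case: K tail => [|k] tail.
  have : 0 <= G (2 * s) by rewrite G0 ?mulr_ge0.
  by rewrite big_ord0; move: GE; lra.
have [xk|kx] := leP x0 k%:R.
  have := tail k (leqnn _) xk; have := G0 _ (v_ge0 k); lra.
have := crude k.+1; rewrite -addn1 natrD; have : 0 <= G (2 * s) by rewrite G0 ?mulr_ge0.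
lra.
Qed.

End exploration_sum.

(** * The sum over tilts *)

Section wrong_stop_sum.
Context (R : realType).
Implicit Types u r : R.

(** The tilts of one block are half-integers times a mesh; the drift turns them
    into this geometric sum, where [u] is the mesh times the drift accumulated
    at the start of the block. *)
Definition half_geometric u (K : nat) : R :=
  \sum_(k < K) expR (- ((k%:R + 2^-1) * u)).

(** Multiplication by [2 sinh (u / 2)] makes the sum telescope. *)
Lemma half_geometricE u K :
  half_geometric u K * (expR (u / 2) - expR (- (u / 2))) = 1 - expR (- (K%:R * u)).
Proof.
elim: K => [|K IHK].
  by rewrite /half_geometric big_ord0 !mul0r oppr0 expR0 subrr.
rewrite /half_geometric big_ord_recr/= mulrDl -/(half_geometric u K) IHK.
rewrite mulrBr -!expRD.
rewrite (_ : - ((K%:R + 2^-1) * u) + u / 2 = - (K%:R * u)); last by field.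
rewrite (_ : - ((K%:R + 2^-1) * u) + - (u / 2) = - (K.+1%:R * u)); last first.
  by rewrite -natr1; field.
by rewrite addrA subrK.
Qed.

Lemma half_geometric_ge0 u K : 0 <= half_geometric u K.
Proof. by apply: sumr_ge0 => k _; exact: expR_ge0. Qed.

Lemma half_geometric_le u K c : 0 < c -> c <= expR (u / 2) - expR (- (u / 2)) ->
  half_geometric u K <= c^-1.
Proof.
move=> c0 cw; rewrite -[leRHS]mul1r ler_pdivlMr//.
apply: (@le_trans _ _ (half_geometric u K * (expR (u / 2) - expR (- (u / 2))))).
  by rewrite ler_wpM2l// half_geometric_ge0.
by rewrite half_geometricE gerBl expR_ge0.
Qed.

Lemma half_geometric_card u K : 0 <= u -> half_geometric u K <= K%:R.
Proof.
move=> u0; rewrite -[K in K%:R]card_ord -sum1_card natr_sum; apply: ler_sum => k _.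
by rewrite -expR0 ler_expR oppr_le0 mulr_ge0// addr_ge0// invr_ge0.
Qed.

(** With [x = u / 2] and [E = exp x], the claim is [E^2 - 2 x E - 1 >= 0],
    which holds at [E = 1 + x + x^2 / 2] and beyond. *)
Lemma two_sinh_ge u : 0 <= u -> u <= expR (u / 2) - expR (- (u / 2)).
Proof.
move=> u0; set x := u / 2; have x0 : 0 <= x by rewrite divr_ge0.
have := expR_ge_quad x0; rewrite expRN; set E := expR x => EQ.
have E0 : 0 < E by exact: expR_gt0.
rewrite (_ : u = 2 * x); last by rewrite /x; field.
rewrite -subr_ge0 (_ : _ - _ = (E ^+ 2 - 2 * x * E - 1) / E); last first.
  by field; rewrite gt_eqF.
rewrite divr_ge0 ?(ltW E0)//; nra.
Qed.

(** A cubic lower bound makes the contributions of large [u] summable over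
    dyadic scales. It comes from [exp (u / 2) = exp (u / 6) ^ 3] and from the
    tangent of [exp] at [1], where [exp 1 >= 5/2]. *)
Lemma two_sinh_ge_cube u : 4 <= u -> u ^+ 3 / 16 <= expR (u / 2) - expR (- (u / 2)).
Proof.
move=> u4; have e1 : 5 / 2 <= expR 1 :> R.
  by have := @expR_ge_quad R 1 ler01; lra.
have e6 : 5 / 12 * u <= expR (u / 6).
  rewrite (_ : u / 6 = 1 + (u / 6 - 1)); last by ring.
  rewrite expRD; have := expR_ge1Dx (u / 6 - 1); nra.
have eN : expR (- (u / 2)) <= 3^-1.
  rewrite expRN lef_pV2 ?posrE ?expR_gt0//.
  by have := expR_ge1Dx (u / 2); lra.
have e2 : (5 / 12 * u) ^+ 3 <= expR (u / 2).
  rewrite (_ : u / 2 = 3%:R * (u / 6)); last by field.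
  by rewrite expRM_natl lerXn2r ?nnegrE ?expR_ge0//; lra.
have u3 : 64 <= u ^+ 3.
  by rewrite (_ : 64 = 4 ^+ 3); [rewrite lerXn2r ?nnegrE//; lra|ring].
move: e2; rewrite exprMn; lra.
Qed.

(** Increments of this function from [u] to [2 u] dominate the contribution of
    the scale [u] to the sum over blocks. The first summand grows by [3 r u]
    as long as [u <= 1], where many tilts are needed. The second grows by at
    least [u] while [u <= 4] and by [16 / u] afterwards, where the drift
    dominates; the constant [12] makes it continuous at [4]. *)
Definition potential r u : R :=
  3 * r * Num.min u 2 + (if u <= 4 then u else 12 - 32 / u).

Lemma potential_ge0 r u : 0 <= r -> 0 <= u -> 0 <= potential r u.
Proof.
move=> r0 u0; rewrite /potential; apply: addr_ge0.
  by apply: mulr_ge0; [exact: mulr_ge0|rewrite le_min u0/=].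
have [//|u4] := leP u 4.
by rewrite subr_ge0 ler_pdivrMr; lra.
Qed.

Lemma potential_le r u : 0 <= r -> 0 < u -> potential r u <= 6 * r + 12.
Proof.
move=> r0 u0; rewrite /potential lerD//.
  have : Num.min u 2 <= 2 by rewrite ge_min lexx orbT.
  by nra.
have [u4|u4] := leP u 4; first lra.
by rewrite gerBl divr_ge0// ltW.
Qed.

(** Three bounds on [u^2] times the geometric sum are used: [u^2 K] when
    [u <= 1], and [u^2 / (2 sinh (u / 2))], which is at most [u] in general
    and at most [16 / u] when [u >= 4]. *)
Lemma half_geometric_potential r u K : 1 <= r -> 0 < u ->
  (u <= 1 -> K%:R <= r + (u * r)^-1 + 1) ->
  u ^+ 2 * half_geometric u K <= potential r (2 * u) - potential r u.
Proof.
move=> r1 u0 Ku; rewrite /potential.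
have u20 : 0 < u ^+ 2 by rewrite exprn_gt0.
have r0 : 0 < r by lra.
have Fu : u ^+ 2 * half_geometric u K <= u.
  have := half_geometric_le K u0 (two_sinh_ge (ltW u0)).
  move=> /(ler_wpM2l (ltW u20)) /le_trans; apply.
  by rewrite expr2 mulfK ?gt_eqF.
have minD : 0 <= Num.min (2 * u) 2 - Num.min u 2.
  by rewrite subr_ge0 le_min ge_min ge_min lexx orbT andbT; apply/orP; left; lra.
have minT : 0 <= 3 * r * (Num.min (2 * u) 2 - Num.min u 2).
  by rewrite mulr_ge0// mulr_ge0// ltW.
have [u4|u4] := leP u 4; last first.
  rewrite ifF /=; last by apply/negbTE; rewrite -ltNge; lra.
  have F16 : u ^+ 2 * half_geometric u K <= 16 / u.
    have c0 : 0 < u ^+ 3 / 16 by rewrite divr_gt0// exprn_gt0.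
    have := half_geometric_le K c0 (two_sinh_ge_cube (ltW u4)).
    move=> /(ler_wpM2l (ltW u20)) /le_trans; apply.
    by rewrite le_eqVlt; apply/predU1P; left; field; rewrite gt_eqF.
  have -> : 32 / (2 * u) = 16 / u by field; rewrite gt_eqF.
  move: minT F16; rewrite (_ : 32 / u = 2 * (16 / u)); last by ring.
  lra.
have psi : u <= (if 2 * u <= 4 then 2 * u else 12 - 32 / (2 * u)) - u.
  have [u2|u2] := leP (2 * u) 4; first lra.
  have -> : 32 / (2 * u) = 16 / u by field; rewrite gt_eqF.
  rewrite -subr_ge0 (_ : _ - _ = 2 * (u - 2) * (4 - u) / u); last first.
    by field; rewrite gt_eqF.
  apply: divr_ge0; last exact: ltW.
  by apply: mulr_ge0; lra.
have [u1|u1] := leP u 1; last by move: minT psi Fu => /=; lra.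
have := half_geometric_card K (ltW u0).
move=> /le_trans /(_ (Ku u1)) /(ler_wpM2l (ltW u20)) F1.
rewrite !min_l; [|lra|lra].
have : u ^+ 2 * (r + (u * r)^-1 + 1) <= 3 * r * u.
  rewrite (_ : u ^+ 2 * _ = u * (u * (r + 1) + r^-1)); last by field; rewrite !gt_eqF.
  rewrite [leRHS]mulrC ler_wpM2l ?(ltW u0)//.
  have : r^-1 <= 1 by rewrite invf_le1.
  nra.
move: F1 psi => /=; lra.
Qed.

(** The bounds of [half_geometric_potential] telescope along the dyadic scales
    [D 2^j]. *)
Lemma wrong_stop_sum r D (K : nat -> nat) (J : nat) : 1 <= r -> 0 < D ->
  (forall j, D * 2 ^+ j <= 1 -> (K j)%:R <= r + (D * 2 ^+ j * r)^-1 + 1) ->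
  \sum_(j < J) (D * 2 ^+ j) ^+ 2 * half_geometric (D * 2 ^+ j) (K j) <= 6 * r + 12.
Proof.
move=> r1 D0 hK; pose v j : R := D * 2 ^+ j.
have v0 j : 0 < v j by rewrite mulr_gt0// exprn_gt0.
have r0 : 0 <= r by lra.
apply: (@le_trans _ _ (potential r (v J) - potential r (v 0%N))); last first.
  have := potential_ge0 r0 (ltW (v0 0%N)); have := potential_le r0 (v0 J); lra.
elim: J => [|J IHJ]; first by rewrite big_ord0 subrr.
rewrite big_ord_recr/=; have := half_geometric_potential r1 (v0 J) (hK J).
rewrite (_ : 2 * v J = v J.+1); last by rewrite /v exprS; ring.
rewrite -/(v J); lra.
Qed.

End wrong_stop_sum.

(** * Well separated arms *)

Section separated_arms.
Context d (Omega : measurableType d) (R : realType) (P : probability Omega R).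
Variables (mu : 'I_2 -> R) (Y : 'I_2 * nat -> {RV P >-> R}) (T : nat).
Hypothesis bandit : gaussian_bandit mu Y.
Variables (a b : 'I_2).
Hypothesis ab : a != b.
Let D := mu b - mu a.
Let L := ln (T%:R * D ^+ 2 / 4).
Let s := Num.sqrt L.
Hypothesis mu_ab : mu a < mu b.
Hypothesis horizon_large : 4 * expR 1 ^+ 2 < T%:R * D ^+ 2.

Let D0 : 0 < D. Proof. by rewrite subr_gt0. Qed.

Let T_gt0 : (0 < T)%N.
Proof.
rewrite lt0n; apply/eqP => T0; move: horizon_large.
by rewrite T0 mul0r ltNge mulr_ge0// sqr_ge0.
Qed.

Let TR_gt0 : 0 < T%:R :> R. Proof. by rewrite ltr0n. Qed.

Let y_gt0 : 0 < T%:R * D ^+ 2 / 4.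
Proof. by rewrite divr_gt0// mulr_gt0// exprn_gt0. Qed.

Let L_ge2 : 2 <= L. Proof. exact: ln_quarter_ge2. Qed.

Let s2 : s ^+ 2 = L. Proof. by rewrite sqr_sqrtr//; move: L_ge2; lra. Qed.

Let s_ge1 : 1 <= s.
Proof. by rewrite -[1]sqrtr1 ler_wsqrtr//; move: L_ge2; lra. Qed.

(** The boundary of the test, for the accumulated gap instead of the difference
    of the means. *)
Lemma threshold_scaled m : (0 < m)%N -> (2 * m <= T)%N ->
  m%:R * threshold R T m =
  2 * (Num.sqrt m%:R * Num.sqrt (ln (T%:R / (2 * m)%:R))).
Proof.
move=> m0 mT; have mR : 0 < m%:R :> R by rewrite ltr0n.
have l0 : 0 <= ln (T%:R / (2 * m)%:R) :> R.
  by rewrite ln_ge0// ler_pdivlMr ?mul1r ?ler_nat// ltr0n muln_gt0.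
rewrite /threshold -[in RHS]sqrtrM; last exact: ltW.
have e2 : 2 = Num.sqrt 4 :> R.
  by rewrite (_ : 4 = 2 ^+ 2) ?sqrtr_sqr ?ger0_norm//; ring.
rewrite {1}e2 -sqrtrM//.
have mE : m%:R = Num.sqrt (m%:R ^+ 2) :> R by rewrite sqrtr_sqr ger0_norm.
rewrite [X in X * _ = _]mE -sqrtrM ?sqr_ge0//.
by congr Num.sqrt; field; rewrite gt_eqF.
Qed.

(** A failed test at [m] means that the gap is at most [2 sqrt m sqrt (l m)],
    while its mean is [m D]; the tilt [1 / sqrt m] turns this into a crossing.
    The assumption on [m] implies [m D^2 >= 2], hence [l m <= L]. *)
Lemma not_stopped_prob m : (m < T./2.+1)%N -> 2 * s <= D * Num.sqrt m%:R ->
  (P (~` [set w | stops_after T (Y ^~ w) m]) <=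
    (expR (1 - (D * Num.sqrt m%:R - 2 * s)))%:E)%E.
Proof.
move=> mT sm.
have m0 : (0 < m)%N.
  by rewrite lt0n; apply/eqP => m0; move: sm s_ge1; rewrite m0 sqrtr0 mulr0; lra.
have m2T : (2 * m <= T)%N.
  by rewrite -(odd_double_half T) mul2n (leq_trans _ (leq_addl _ _))// leq_double -ltnS.
have mR : 0 < m%:R :> R by rewrite ltr0n.
have q0 : 0 < Num.sqrt m%:R :> R by rewrite sqrtr_gt0.
have q2 : Num.sqrt m%:R ^+ 2 = m%:R :> R by rewrite sqr_sqrtr// ltW.
have lL : Num.sqrt (ln (T%:R / (2 * m)%:R)) <= s.
  rewrite /s ler_wsqrtr// /L ler_ln ?posrE//; last first.
    by rewrite divr_gt0// ltr0n muln_gt0.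
  rewrite ler_pdivrMr ?ltr0n ?muln_gt0// natrM.
  have : (2 * s) ^+ 2 <= (D * Num.sqrt m%:R) ^+ 2.
    by rewrite ler_pXn2r ?nnegrE//; [move: s_ge1; lra|rewrite mulr_ge0// ltW].
  rewrite exprMn s2 exprMn q2 => DL.
  have : 2 <= D ^+ 2 * m%:R by move: L_ge2; lra.
  by move=> /(ler_wpM2l (ltW TR_gt0)); lra.
pose x := D * Num.sqrt m%:R - 2 * s - 1.
have -> : 1 - (D * Num.sqrt m%:R - 2 * s) = - x by rewrite /x; ring.
apply: le_trans (gap_crossing_prob bandit ab (Num.sqrt m%:R)^-1 x m).
apply: le_measure; rewrite ?inE.
- by apply: measurableC; exact: measurable_stops_after.
- exact: measurable_gap_crossing.
move=> w /= /negP; rewrite /stops_after -leNgt => nst; exists m => //.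
have gapm : gap_sum a b (Y ^~ w) m <= 2 * (Num.sqrt m%:R * s).
  apply: le_trans (ler_norm _) _; rewrite norm_gap_sum//.
  apply: (@le_trans _ _ (m%:R * threshold R T m)); first by rewrite ler_wpM2l.
  by rewrite threshold_scaled// ler_wpM2l// ler_wpM2l// ltW.
rewrite exprVn q2 mulVf ?gt_eqF// -/D /x lerD2r [leRHS]mulrC ler_pdivlMr//.
by rewrite mulrBl -mulrA -expr2 q2; lra.
Qed.

(** Centres of the cells of a grid of mesh [2^-j]. *)
Definition tilt (j k : nat) : R := (k%:R + 2^-1) / 2 ^+ j.

(** What the tilt [tilt j k] achieves at least on block [j]: the logarithm is
    the smallest value of [l n] on the block, [1] is the loss due to the grid,
    and the last term is the drift. *)
Definition tilt_level (j k : nat) : R :=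
  ln (T%:R / (8 * 4 ^+ j)) - 1 + (k%:R + 2^-1) * (D * 2 ^+ j).

(** The optimal tilts on block [j] do not exceed [sqrt (l (4^j)) / 2^j], which
    lies in the cell of index [truncn (sqrt (l (4^j)))]. *)
Definition tilt_count (j : nat) : nat :=
  (Num.truncn (Num.sqrt (ln (T%:R / (2 * 4 ^+ j)) : R))).+1.

(** For a tilt [lam], the exponent at the boundary is
    [l n - n (lam - ls)^2], where [ls = sqrt (l n / n)] is the optimal tilt.
    In the cell of [ls], the error is at most [2^-j / 2], and [n < 4^(j+1)], so
    the loss is at most [1]. *)
Lemma wrong_stop_crossing w : wrong_stop T a b (Y ^~ w) ->
  exists j, [/\ (j < T)%N & exists2 k, (k < tilt_count j)%N &
    gap_crossing mu Y a b (tilt j k) (tilt_level j k) T w].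
Proof.
move=> /hasP[n]; rewrite mem_iota add1n ltnS => /andP[n0 nT] /andP[stn gap0].
have n2T : (2 * n <= T)%N.
  by rewrite -(odd_double_half T) mul2n (leq_trans _ (leq_addl _ _))// leq_double.
have nR : 0 < n%:R :> R by rewrite ltr0n.
have q0 : 0 < Num.sqrt n%:R :> R by rewrite sqrtr_gt0.
have q2 : Num.sqrt n%:R ^+ 2 = n%:R :> R by rewrite sqr_sqrtr// ltW.
pose l : R := ln (T%:R / (2 * n)%:R).
have l0 : 0 <= l by rewrite ln_ge0// ler_pdivlMr ?mul1r ?ler_nat// ltr0n muln_gt0.
have gapn : 2 * (Num.sqrt n%:R * Num.sqrt l) <= - gap_sum a b (Y ^~ w) n.
  rewrite -threshold_scaled// -ler0_norm ?(ltW gap0)// norm_gap_sum//.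
  by rewrite ler_wpM2l ?ler0n// ltW.
(* The block of [n]. *)
pose j := trunc_log 4 n.
have /andP[jn nj] : (4 ^ j <= n < 4 ^ j.+1)%N by exact: trunc_log_bounds.
pose p : R := 2 ^+ j.
have p0 : 0 < p by rewrite exprn_gt0.
have p2 : p ^+ 2 = 4 ^+ j by rewrite -exprM mulnC exprM; congr (_ ^+ _); ring.
have jnR : p ^+ 2 <= n%:R by rewrite p2 -natrX ler_nat.
have njR : n%:R <= 4 * p ^+ 2.
  by rewrite p2 -exprS -natrX ler_nat ltnW.
(* The optimal tilt and the index of its cell. *)
pose ls := Num.sqrt l / Num.sqrt n%:R.
have ls0 : 0 <= ls by rewrite divr_ge0// sqrtr_ge0.
pose k := Num.truncn (ls * p).
have /andP[kl lk] := truncn_itv (mulr_ge0 ls0 (ltW p0)); rewrite -/k in kl lk.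
exists j; split.
  apply: leq_trans (ltn_expl j (isT : 1 < 4)%N) _; apply: leq_trans jn _.
  by apply: leq_trans n2T; exact: leq_pmull.
exists k.
  rewrite ltnS; apply: le_truncn.
  apply: (@le_trans _ _ (Num.sqrt l)).
    rewrite /ls mulrAC ler_pdivrMr// ler_wpM2l ?sqrtr_ge0//.
    by rewrite -(@ler_pXn2r _ 2) ?nnegrE ?sqrtr_ge0 ?(ltW p0)// q2.
  rewrite ler_wsqrtr// ler_ln ?posrE ?divr_gt0 ?mulr_gt0 ?exprn_gt0 ?ltr0n ?muln_gt0//.
  rewrite ler_wpM2l ?(ltW TR_gt0)//.
  rewrite lef_pV2 ?posrE ?mulr_gt0 ?exprn_gt0 ?ltr0n ?muln_gt0//.
  by rewrite natrM ler_wpM2l// -p2.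
exists n; first by apply: leq_trans n2T; exact: leq_pmull.
rewrite -/D /tilt_level -/p; set lam := tilt j k.
have lamE : lam = (k%:R + 2^-1) / p by [].
have lam0 : 0 < lam by rewrite lamE divr_gt0// ltr_wpDl.
have err : n%:R * (lam - ls) ^+ 2 <= 1.
  have : (p * (lam - ls)) ^+ 2 <= 2^-1 ^+ 2.
    rewrite -ler_sqrt ?sqr_ge0// !sqrtr_sqr (@ger0_norm _ 2^-1) ?invr_ge0//.
    rewrite ler_norml mulrBr lamE mulrC mulrVK ?unitfE ?gt_eqF//.
    move: kl lk; rewrite -natr1; lra.
  rewrite exprMn; have := sqr_ge0 (lam - ls); nra.
have level : ln (T%:R / (8 * 4 ^+ j)) <= l.
  rewrite ler_ln ?posrE ?divr_gt0 ?mulr_gt0 ?exprn_gt0 ?ltr0n ?muln_gt0//.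
  rewrite ler_wpM2l ?(ltW TR_gt0)//.
  rewrite lef_pV2 ?posrE ?mulr_gt0 ?exprn_gt0 ?ltr0n ?muln_gt0//.
  by rewrite natrM -p2; move: njR; lra.
have drift : (k%:R + 2^-1) * (D * p) <= lam * (n%:R * D).
  rewrite lamE (_ : _ * (n%:R * D) = (k%:R + 2^-1) * (D * (n%:R / p))); last by ring.
  rewrite ler_wpM2l ?addr_ge0 ?invr_ge0// ler_wpM2l ?(ltW D0)//.
  by rewrite ler_pdivlMr// -expr2.
have cross : lam * (2 * (Num.sqrt n%:R * Num.sqrt l)) - lam ^+ 2 * n%:R
    = l - n%:R * (lam - ls) ^+ 2.
  have -> : Num.sqrt n%:R * Num.sqrt l = n%:R * ls.
    by rewrite /ls -{2}q2; field; rewrite gt_eqF.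
  have -> : l = n%:R * ls ^+ 2.
    by rewrite /ls exprMn exprVn q2 sqr_sqrtr// mulrC mulfVK ?gt_eqF.
  ring.
have := ler_wpM2l (ltW lam0) gapn.
rewrite mulrBr; move: cross err level drift; lra.
Qed.

(** A union bound over all blocks and tilts. The factor [24 >= 8 exp 1] comes
    from the loss of [1] in the exponent, from the factor [4] between [4^j] and
    the end of the block, and from the [2] in [T / (2 n)]. *)
Lemma wrong_stop_prob :
  (T%:R%:E * P [set w | wrong_stop T a b (Y ^~ w)] <=
   (24 * (6 * s + 12) / D ^+ 2)%:E)%E.
Proof.
pose E j k := gap_crossing mu Y a b (tilt j k) (tilt_level j k) T.
have mE j k : measurable (E j k) by exact: measurable_gap_crossing.
pose F j := \big[setU/set0]_(k < tilt_count j) E j k.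
have mF j : measurable (F j) by apply: bigsetU_measurable => k _.
have PF j : (P (F j) <= \sum_(k < tilt_count j) (expR (- tilt_level j k))%:E)%E.
  apply: (@le_trans _ _ (\sum_(k < tilt_count j) P (E j k))%E).
    exact: (content_subadditive P).
  by apply: lee_sum => k _; exact: gap_crossing_prob.
have PW : (P [set w | wrong_stop T a b (Y ^~ w)] <= \sum_(j < T) P (F j))%E.
  apply: (content_subadditive P) => //; first exact: measurable_wrong_stop.
  move=> w /= /wrong_stop_crossing[j [jT [k kK wE]]].
  rewrite -bigcup_mkord; exists j => //.
  by rewrite /F -bigcup_mkord; exists k.
apply: (@le_trans _ _ (T%:R%:E * (\sum_(j < T) \sum_(k < tilt_count j)
    expR (- tilt_level j k))%:E)%E).
  rewrite lee_wpmul2l//.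
  apply: le_trans PW _; rewrite -sumEFin; apply: lee_sum => j _.
  by rewrite -sumEFin.
rewrite -EFinM lee_fin.
have level j k : T%:R * expR (- tilt_level j k) =
    8 * expR 1 / D ^+ 2 * ((D * 2 ^+ j) ^+ 2 * expR (- ((k%:R + 2^-1) * (D * 2 ^+ j)))).
  rewrite /tilt_level opprD opprB expRD expRB lnK; last first.
    by rewrite posrE divr_gt0// mulr_gt0// exprn_gt0.
  have -> : (D * 2 ^+ j) ^+ 2 = D ^+ 2 * 4 ^+ j.
    by rewrite exprMn -exprM mulnC exprM; congr (_ * _ ^+ _); ring.
  by field; rewrite !gt_eqF// exprn_gt0.
have -> : T%:R * (\sum_(j < T) \sum_(k < tilt_count j) expR (- tilt_level j k)) =
    8 * expR 1 / D ^+ 2 *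
    \sum_(j < T) (D * 2 ^+ j) ^+ 2 * half_geometric (D * 2 ^+ j) (tilt_count j).
  rewrite !mulr_sumr; apply: eq_bigr => j _; rewrite !mulr_sumr.
  by apply: eq_bigr => k _; rewrite level.
apply: (@le_trans _ _ (8 * expR 1 / D ^+ 2 * (6 * s + 12))).
  apply: ler_wpM2l.
    by apply: divr_ge0; [rewrite mulr_ge0// expR_ge0|exact: sqr_ge0].
  apply: wrong_stop_sum => // j; set u := D * 2 ^+ j => u1.
  have u0 : 0 < u by rewrite mulr_gt0// exprn_gt0.
  set r := u^-1; have r0 : 0 < r by rewrite invr_gt0.
  rewrite /tilt_count; set l := ln _.
  (* Since [T / (2 * 4 ^ j) = (T D^2 / 4) * 2 / u^2] and [ln x <= x - 1], [l] is
     at most [L - 1 + 2 / u]. *)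
  have lE : l = L + ln 2 + ln r + ln r.
    rewrite /l /L -!lnM ?posrE ?mulr_gt0//; congr ln.
    have p2 : (2 ^+ j) ^+ 2 = 4 ^+ j :> R.
      by rewrite -exprM mulnC exprM; congr (_ ^+ _); ring.
    rewrite /r /u -p2; field; rewrite !gt_eqF// exprn_gt0//.
  have lb : l <= (s + (u * s)^-1) ^+ 2.
    rewrite lE -s2 sqrrD (_ : s * (u * s)^-1 = r); last first.
      by rewrite /r; field; rewrite !gt_eqF//; move: s_ge1; lra.
    have := ln_le_sub1 r0; have := @ln_le_sub1 R 2 ltac:(lra);
     have := sqr_ge0 ((u * s)^-1).
    rewrite mulr2n; lra.
  have sl : Num.sqrt l <= s + (u * s)^-1.
    have p0 : 0 <= s + (u * s)^-1.
      by rewrite addr_ge0 ?sqrtr_ge0// invr_ge0 mulr_ge0 ?sqrtr_ge0// ltW.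
    by rewrite -[leRHS](ger0_norm p0) -sqrtr_sqr ler_wsqrtr.
  rewrite -natr1 lerD2r; apply: le_trans sl.
  by rewrite truncn_le sqrtr_ge0.
rewrite mulrAC ler_pM2r ?invr_gt0 ?exprn_gt0//.
rewrite ler_wpM2r//; first by move: s_ge1; lra.
by have := expR1_le3 R; lra.
Qed.

Lemma regret_le_separated :
  (regret P mu T (fun t w => bai_etc T (Y ^~ w) t) <=
   ((4 * L + 156 * s + 294) / D + 2 * D)%:E)%E.
Proof.
apply: le_trans (regret_le Y T ab (ltW mu_ab)) _; rewrite -/D.
pose f m := fine (P (~` [set w | stops_after T (Y ^~ w) m])).
have mst m : measurable (~` [set w | stops_after T (Y ^~ w) m]).
  by apply: measurableC; exact: measurable_stops_after.
have fE m : (f m)%:E = P (~` [set w | stops_after T (Y ^~ w) m]).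
  by rewrite /f fineK// fin_num_measure.
have fsum : \sum_(m < T./2.+1) f m <=
    4 * s ^+ 2 / D ^+ 2 + 2 + 6 * (1 + 2 * s) / D ^+ 2.
  apply: exploration_sum => //; first by move: s_ge1; lra.
  - by move=> m; rewrite -lee_fin fE probability_le1.
  - by move=> m mT sm; rewrite -lee_fin fE not_stopped_prob.
apply: (@le_trans _ _ (D%:E * ((4 * s ^+ 2 / D ^+ 2 + 2 + 6 * (1 + 2 * s) / D ^+ 2)%:E +
    (24 * (6 * s + 12) / D ^+ 2)%:E))%E).
  rewrite lee_wpmul2l ?lee_fin ?(ltW D0)// leeD ?wrong_stop_prob//.
  by under eq_bigr do rewrite -fE; rewrite sumEFin lee_fin.
rewrite -EFinD -EFinM lee_fin le_eqVlt; apply/predU1P; left.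
by rewrite s2; field; rewrite gt_eqF.
Qed.

End separated_arms.

(** * The regret bounds *)

Section ordered_arms.
Context d (Omega : measurableType d) (R : realType) (P : probability Omega R).
Variables (mu : 'I_2 -> R) (Y : 'I_2 * nat -> {RV P >-> R}) (T : nat).
Hypothesis bandit : gaussian_bandit mu Y.
Variables (a b : 'I_2).
Hypotheses (ab : a != b) (mu_ab : mu a <= mu b).
Let D := mu b - mu a.
Let L := ln (T%:R * D ^+ 2 / 4).
Let regret_bai_etc := regret P mu T (fun t w => bai_etc T (Y ^~ w) t).

Let D_ge0 : 0 <= D. Proof. by rewrite subr_ge0. Qed.

Let large_gap : 4 * expR 1 ^+ 2 < T%:R * D ^+ 2 -> mu a < mu b /\ 0 < D.
Proof.
move=> TD; have D0 : 0 < D.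
  rewrite lt_neqAle D_ge0 andbT; apply/eqP => D0; move: TD.
  by rewrite -D0 expr0n/= mulr0 ltNge mulr_ge0// sqr_ge0.
by split=> //; rewrite -subr_gt0.
Qed.

Lemma regret_large_gap : 4 * expR 1 ^+ 2 < T%:R * D ^+ 2 ->
  (regret_bai_etc <= (4 * L / D + 334 * Num.sqrt L / D + 178 / D + 2 * D)%:E)%E.
Proof.
move=> TD; have [mu_lt D0] := large_gap TD.
apply: le_trans (regret_le_separated bandit ab mu_lt TD) _.
rewrite lee_fin lerD2r -/D -/L -!mulrDl ler_pM2r ?invr_gt0//.
have : 1 <= Num.sqrt L.
  by rewrite -[1]sqrtr1 ler_wsqrtr//; have : 2 <= L := ln_quarter_ge2 TD; lra.
by lra.
Qed.

(** Let [z = sqrt T D / 2]. If [z <= 16] the trivial bound [T D] is at most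
    [32 sqrt T]. Otherwise [L = 2 ln z], and after multiplication by [D] the
    bound for separated arms has to be compared with [64 z], where tangents to
    the logarithm and to the square root suffice. *)
Lemma regret_minimax : (regret_bai_etc <= (32 * Num.sqrt T%:R + 2 * D)%:E)%E.
Proof.
have qT0 : 0 <= Num.sqrt T%:R :> R by exact: sqrtr_ge0.
have qT2 : Num.sqrt T%:R ^+ 2 = T%:R :> R by rewrite sqr_sqrtr.
have [small|large] := leP (T%:R * D ^+ 2) 1024.
  apply: le_trans (regret_le_horizon Y T ab mu_ab) _; rewrite lee_fin -/D.
  apply: (@le_trans _ _ (32 * Num.sqrt T%:R)); last by rewrite lerDl mulr_ge0.
  have : Num.sqrt T%:R * D <= 32.
    rewrite -(@ler_pXn2r _ 2) ?nnegrE ?mulr_ge0// exprMn qT2.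
    by apply: le_trans small _; rewrite (_ : 32 ^+ 2 = 1024)//; ring.
  have -> : T%:R * D = Num.sqrt T%:R * (Num.sqrt T%:R * D) by rewrite mulrA -expr2 qT2.
  by move=> qD; rewrite [leRHS]mulrC; exact: ler_wpM2l.
have TD : 4 * expR 1 ^+ 2 < T%:R * D ^+ 2.
  have e0 : 0 <= expR 1 :> R by exact: expR_ge0.
  have := expR1_le3 R; move: large; nra.
have [mu_lt D0] := large_gap TD.
apply: le_trans (regret_le_separated bandit ab mu_lt TD) _.
rewrite lee_fin lerD2r -/D -/L ler_pdivrMr//.
pose z := Num.sqrt T%:R * D / 2.
have z2 : z ^+ 2 = T%:R * D ^+ 2 / 4.
  by rewrite /z !exprMn qT2 exprVn; field.
have z16 : 16 < z.
  have z0 : 0 <= z by rewrite divr_ge0// mulr_ge0.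
  rewrite -(@ltr_pXn2r _ 2) ?nnegrE// z2; move: large; lra.
have z0 : 0 < z by lra.
have LE : L = 2 * ln z by rewrite /L -z2 lnXn// mulr_natl.
have lnz : ln z <= z / 4 + 2.
  have z4 : 0 < z / 4 by lra.
  rewrite (_ : ln z = ln (z / 4) + ln 4); last first.
    by rewrite -lnM ?posrE//; congr ln; field.
  have := ln_le_sub1 z4; have := @ln_le_sub1 R 4 ltac:(lra); lra.
have sL : Num.sqrt L <= (L + 4) / 4.
  have L0 : 0 <= L by have : 2 <= L := ln_quarter_ge2 TD; lra.
  have := sqr_ge0 (Num.sqrt L - 2); rewrite sqrrB sqr_sqrtr// mulr2n; lra.
have -> : 32 * Num.sqrt T%:R * D = 64 * z by rewrite /z; field.
by move: sL; rewrite LE; lra.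
Qed.

End ordered_arms.

Local Close Scope classical_set_scope.

Theorem theorem5 (R : realType) (d : measure_display) (Omega : measurableType d)
    (P : probability Omega R) (mu : 'I_2 -> R)
    (Y : 'I_2 * nat -> {RV P >-> R}) (T : nat) :
  (3 <= T)%N ->
  gaussian_bandit mu Y ->
  let Delta := `|mu arm1 - mu arm2| in
  let regret_bai_etc :=
    regret P mu T (fun t w => bai_etc T (fun ik => Y ik w) t) in
  let L := ln (T%:R * Delta ^+ 2 / 4) in
  [/\ 4 * expR 1 ^+ 2 < T%:R * Delta ^+ 2 ->
      (regret_bai_etc <=
        (4 * L / Delta + 334 * Num.sqrt L / Delta + 178 / Delta
          + 2 * Delta)%:E)%E,
      T%:R * Delta ^+ 2 <= 4 * expR 1 ^+ 2 ->
      (regret_bai_etc <= (T%:R * Delta)%:E)%E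
    & (regret_bai_etc <= (32 * Num.sqrt T%:R + 2 * Delta)%:E)%E ].
Proof.
move=> _ bandit Delta regret_bai_etc L.
have [a [b [ab mu_ab DE]]] : exists a b : 'I_2,
    [/\ a != b, mu a <= mu b & Delta = mu b - mu a].
  have [le12|/ltW le21] := leP (mu arm1) (mu arm2).
    exists arm1, arm2; split=> //.
    by rewrite /Delta distrC ger0_norm// subr_ge0.
  exists arm2, arm1; split=> //.
  by rewrite /Delta ger0_norm// subr_ge0.
rewrite /L DE; split; first exact: regret_large_gap.
  by move=> _; exact: regret_le_horizon.
exact: regret_minimax.
Qed.
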